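(* Consider a $\pi$-regular saddle-point problem $\min_{x\in\mathcal X}\max_{y\in\mathcal Y}f(x)+\langle y,\mathbf Bx\rangle-g(y)$ with an admissible parameter vector $\pi=(L_x,L_y,L_{xy},\mu_x,\mu_y,\mu_{xy},\mu_{yx})$ satisfying $L_x>4\mu_x$, $L_y>4\mu_y$, $L_{xy}>18\max\{\mu_{xy},\mu_{yx},\sqrt{\mu_x\mu_y}\}$, $\sqrt{L_xL_y}>4\max\{\mu_{xy},\mu_{yx}\}$, and $\min\{\delta_x,\delta_y\}>0$, where $\delta_x=\mu_x+\mu_{xy}^2/L_y$, $\delta_y=\mu_y+\mu_{yx}^2/L_x$. Let $\kappa_x=L_x/\delta_x$, $\kappa_y=L_y/\delta_y$, $\kappa_{xy}=L_{xy}^2/(\delta_x\delta_y)$, let $R^2=\mathcal R^2_{\delta_x\delta_y}(0,0)$ be the initial distance, $c=1+12\kappa_x+12\kappa_y$, and $\epsilon\in(0,R^2)$. Then, to find $(x,y)$ with $\mathcal R^2_{\delta_x\delta_y}(x,y)\le\epsilon$ by the restarted Algorithm 1 (described in the context) started at $0$, it is sufficient to perform $$\mathcal O\Big(\sqrt{\kappa_x}\log\tfrac{cR^2}{\epsilon}\Big),\qquad \mathcal O\Big(\sqrt{\kappa_y}\log\tfrac{cR^2}{\epsilon}\Big),\qquad \mathcal O\Big(\sqrt{\kappa_{xy}}\log\tfrac{cR^2}{\epsilon}\Big)$$ computations of the gradient $\nabla f$, computations of the gradient $\nabla g$, and matrix-vector multiplications with the matrices $\mathbf B$ and $\mathbf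 B^\top$, respectively, where $\mathcal O(\cdot)$ hides only universal constants. That is, there is a number of restarts $N$ such that the output $(x,y)$ after $N$ restarts satisfies $\mathcal R^2_{\delta_x\delta_y}(x,y)\le\epsilon$ and, over the $N$ runs, the total number of computations of $\nabla f$ is $\mathcal O\big(\sqrt{\kappa_x}\log\tfrac{cR^2}{\epsilon}\big)$, the total number of computations of $\nabla g$ is $\mathcal O\big(\sqrt{\kappa_y}\log\tfrac{cR^2}{\epsilon}\big)$, and the total number of matrix-vector multiplications with $\mathbf B$ and $\mathbf B^\top$ is $\mathcal O\big(\sqrt{\kappa_{xy}}\log\tfrac{cR^2}{\epsilon}\big)$.
   Context: **Problem.** $\mathcal X=\mathbb R^{d_x}$, $\mathcal Y=\mathbb R^{d_y}$, $\mathbf B\in\mathbb R^{d_y\times d_x}$, $f,g$ differentiable convex. $\mathrm D_h(x,x')=h(x)-h(x')-\langle\nabla h(x'),x-x'\rangle$. A differentiable $h$ is $\mu$-strongly convex ($\mu\ge0$) if $\mathrm D_h(x,x')\ge\frac\mu2\|x-x'\|^2$ for all $x,x'$ (convex if $\mu=0$); a differentiable convex $h$ is $L$-smooth if $|\mathrm D_h(x,x')|\le\frac L2\|x-x'\|^2$ for all $x,x'$. **Parameters.** $\pi=(L_x,L_y,L_{xy},\mu_x,\mu_y,\mu_{xy},\mu_{yx})\in\mathbb R_+^7$ is admissible if $L_x>\mu_x\ge0$, $L_y>\mu_y\ge0$, $L_{xy}>\mu_{xy}\ge0$, $L_{xy}>\mu_{yx}\ge0$, and $\mu_{xy}=\mu_{yx}$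 whenever both are positive. The problem is $\pi$-regular if: $f$ is $\mu_x$-strongly convex and $L_x$-smooth; $g$ is $\mu_y$-strongly convex and $L_y$-smooth; $\mu_{xy}^2\le\lambda_{\min}^+(\mathbf B^\top\mathbf B)$ if $\nabla f(x)\in\mathrm{range}\,\mathbf B^\top$ for all $x$, and $\mu_{xy}^2\le\lambda_{\min}(\mathbf B^\top\mathbf B)$ otherwise; $\mu_{yx}^2\le\lambda_{\min}^+(\mathbf B\mathbf B^\top)$ if $\nabla g(y)\in\mathrm{range}\,\mathbf B$ for all $y$, and $\mu_{yx}^2\le\lambda_{\min}(\mathbf B\mathbf B^\top)$ otherwise; $L_{xy}^2\ge\lambda_{\max}(\mathbf B^\top\mathbf B)$. ($\lambda_{\min},\lambda_{\min}^+,\lambda_{\max}$: smallest, smallest positive, largest eigenvalue.) **Solutions.** With $P(x)=f(x)+g^*(\mathbf Bx)$, $D(y)=-g(y)-f^*(-\mathbf B^\top y)$ ($h^*$ the Fenchel conjugate), $\mathcal S_x=\mathrm{Argmin}\,P$, $\mathcal S_y=\mathrm{Argmax}\,D$ (nonempty affine subspaces under the hypotheses). $\mathrm{dist}(x;\mathcal A)=\min_{x'\in\mathcal A}\|x-x'\|$ and $\mathcal R^2_{\delta_x\delta_y}(x,y)=\delta_x\mathrm{dist}^2(x;\mathcal S_x)+\delta_y\mathrm{dist}^2(y;\mathcal S_y)$. **Algorithm 1** (for pairs $(p_i,Q_i)$, $i=1,\dots,n$, a closed convex set $\mathcal C\subset\mathcal Z$, input $z_{\rm in}\in\mathcal C$,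 constants $L_i,M_i$, positive integers $T_1,\dots,T_n$, symmetric positive definite matrix $\mathbf P$, with $\|z\|_{\mathbf P}=\sqrt{\langle\mathbf Pz,z\rangle}$). Let $\alpha_0=1$, $\alpha_{t+1}=2\big(1+\sqrt{1+4/\alpha_t^2}\big)^{-1}$ for $t\ge0$. Write $t_{1:k}$ for $t_1,\dots,t_k$ (empty if $k=0$). Initialization: $z^i_{0,\dots,0}=z_{\rm in}$ ($i$ zero indices) and $p_i^{0}\equiv p_i$ for $i=1,\dots,n$. Output: $z_{\rm out}=\mathrm{Rec}(1)$. The recursive procedure $\mathrm{Rec}(k;t_{1:k-1})$ is: - If $k=n+1$: return $\arg\min_{z\in\mathcal C}\sum_{i=1}^np_i^{n;t_{1:n}}(z)$. - Otherwise set $\bar z^k_0=z^k_{t_{1:k-1},0}$ and, for $t_k=0,1,\dots,T_k-1$, do the following: 1. For $i=1,\dots,n$ set $\hat p_i^{k;t_{1:k}}(z)=\alpha_{t_k}^{-1}\,p_i^{k-1;t_{1:k-1}}\big(\alpha_{t_k}z+(1-\alpha_{t_k})\bar z^k_{t_k}\big)$ if $i\ge k$, and $\hat p_i^{k;t_{1:k}}(z)=p_i^{k-1;t_{1:k-1}}(z)$ if $i<k$; $L_i^{k;t_{1:k}}=L_i\prod_{l=1}^k\alpha_{t_l}$, $M_i^{k;t_{1:k}}=M_i\prod_{l=1}^k(\alpha_{t_l}/\alpha_{T_l-1})$, $H_i^{k;t_{1:k}}=L_i^{k;t_{1:k}}+M_i^{k;t_{1:k}}$; $\Delta_i^{k;t_{1:k}}=\nabla\hat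 p_i^{k;t_{1:k}}(z^k_{t_{1:k}})+Q_i(z^k_{t_{1:k}})$ (used, and computed, only for $i=k$); $p_k^{k;t_{1:k}}(z)=\tfrac12H_k^{k;t_{1:k}}\|z-z^k_{t_{1:k}}\|_{\mathbf P}^2+\langle z,\Delta_k^{k;t_{1:k}}\rangle$, and $p_i^{k;t_{1:k}}\equiv\hat p_i^{k;t_{1:k}}$ for $i\ne k$. 2. $z^k_{t_{1:k-1},t_k+1/2}=\mathrm{Rec}(k+1;t_{1:k})$. 3. $\bar z^k_{t_k+1}=\alpha_{t_k}z^k_{t_{1:k-1},t_k+1/2}+(1-\alpha_{t_k})\bar z^k_{t_k}$. 4. $\Delta_{Q_k}^{k;t_{1:k}}=Q_k(z^k_{t_{1:k}})-Q_k(z^k_{t_{1:k-1},t_k+1/2})$. 5. $z^k_{t_{1:k-1},t_k+1}=z^k_{t_{1:k-1},t_k+1/2}+(H_k^{k;t_{1:k}}\mathbf P)^{-1}\Delta_{Q_k}^{k;t_{1:k}}$. 6. For $l=k+1,\dots,n$: $z^l_{t_{1:k-1},t_k+1,0,\dots,0}=z^l_{t_{1:k-1},t_k,T_{k+1},0,\dots,0}$. After the loop return $\bar z^k_{T_k}$. **Instance used.** For $z_{\rm in}=(x_{\rm in},y_{\rm in})$: $n=3$, $\mathcal Z=\mathcal C=\mathcal X\times\mathcal Y$, $Q_1=Q_2=0$, $Q_3(x,y)=(\mathbf B^\top y,-\mathbf Bx)$, $p_1(x,y)=f(x)$, $p_2(x,y)=g(y)$, $p_3(x,y)=\frac1{8L_y}\|\mathbf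 Bx-\nabla g(y_{\rm in})\|^2+\frac1{8L_x}\|\mathbf B^\top y+\nabla f(x_{\rm in})\|^2$, $\mathbf P=\mathrm{diag}(\delta_x\mathbf I_{d_x},\delta_y\mathbf I_{d_y})$, $L_1=\kappa_x$, $L_2=\kappa_y$, $L_3=\kappa_{xy}$, $M_1=M_2=0$, $M_3=\sqrt{\kappa_{xy}}$. The order of the three pairs and $T_1,T_2,T_3$ are chosen so that, with $\eta=1/72$, the output satisfies $p(z_{\rm out})-p(z)+\langle Q(z),z_{\rm out}-z\rangle\le3\eta\|z_{\rm in}-z\|^2_{\mathbf P}$ for all $z$ ($p=\sum_ip_i$, $Q=\sum_iQ_i$), with at most $6^3\max\{\sqrt{L_i/\eta},M_i/\eta,1\}$ computations of $\nabla p_i$ and $Q_i$ for each $i$ (such a choice exists). **Restarted Algorithm 1.** $z^0=0$; for $t=0,1,\dots,N-1$, writing $z^t=(x^t,y^t)$, $z^{t+1}$ is the output of Algorithm 1 with input $z_{\rm in}=z^t$, run with $n=3$, $\mathcal C=\mathcal X\times\mathcal Y$, the pairs $(p_1,Q_1)=(f(x),0)$, $(p_2,Q_2)=(g(y),0)$, $(p_3,Q_3)=\big(\frac1{8L_y}\|\mathbf Bx-\nabla g(y^t)\|^2+\frac1{8L_x}\|\mathbf B^\top y+\nabla f(x^t)\|^2,\ (\mathbf B^\top y,-\mathbf Bx)\big)$, the matrix $\mathbf P=\mathrm{diag}(\delta_x\mathbf I_{d_x},\delta_y\mathbf I_{d_y})$, the constants $L_1=\kappa_x$, $L_2=\kappa_y$,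 $L_3=\kappa_{xy}$, $M_1=M_2=0$, $M_3=\sqrt{\kappa_{xy}}$, and the order of the pairs and $T_1,T_2,T_3$ chosen as described under ''Instance used''. The output after $N$ restarts is $(x,y)=z^N$. *)

(* Defs.v *)
Set Warnings "-notation-overridden,-ambiguous-paths,-notation-incompatible-prefix".
From mathcomp Require Import all_boot all_order all_algebra all_fingroup.
From mathcomp Require Import all_classical all_reals all_analysis.
Set Implicit Arguments.
Unset Strict Implicit.
Unset Printing Implicit Defensive.
Import Order.TTheory GRing.Theory Num.Theory numFieldNormedType.Exports.
Local Open Scope classical_set_scope.
Local Open Scope ring_scope.

(* R^d is 'cV[R]_d.  The library norm of 'cV[R]_d is the sup norm; it is used only for the notion
   of differentiability, which does not depend on the choice of the norm. *)
Definition dot (R : realType) (d : nat) (u v : 'cV[R]_d) : R :=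
  \sum_(i < d) u i 0 * v i 0.

Definition enorm (R : realType) (d : nat) (u : 'cV[R]_d) : R :=
  Num.sqrt (dot u u).

Definition mxnorm_of (R : realType) (d : nat) (Pm : 'M[R]_d) (u : 'cV[R]_d) : R :=
  Num.sqrt (dot (Pm *m u) u).

Definition grad (R : realType) (d : nat) (h : 'cV[R]_d -> R) (x : 'cV[R]_d) :
    'cV[R]_d :=
  \col_(i < d) ('D_(delta_mx i 0) h x).

Section Convexity.
Variables (R : realType) (d : nat).
Implicit Types h : 'cV[R]_d -> R.

Definition bregman h (x x' : 'cV[R]_d) : R :=
  h x - h x' - dot (grad h x') (x - x').

Definition strongly_convex (mu : R) h : Prop :=
  forall x x', mu / 2 * enorm (x - x') ^+ 2 <= bregman h x x'.

Definition smooth (L : R) h : Prop :=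
  forall x x', `|bregman h x x'| <= L / 2 * enorm (x - x') ^+ 2.

Definition conjugate h (u : 'cV[R]_d) : \bar R :=
  ereal_sup [set (dot u x - h x)%:E | x in [set: 'cV[R]_d]].

End Convexity.

(* Extreme eigenvalues, with values in \bar R: the spectrum is finite, so the
   infimum (supremum) is a minimum (maximum) as soon as the set is nonempty; a
   minimum over the empty set (e.g. lambda_min_pos 0) is +oo. *)
Section Spectrum.
Variables (R : realType) (d : nat).
Implicit Types A : 'M[R]_d.

Definition lambda_min A : \bar R :=
  ereal_inf [set a%:E | a in [set a : R | eigenvalue A a]].

Definition lambda_min_pos A : \bar R :=
  ereal_inf [set a%:E | a in [set a : R | eigenvalue A a /\ 0 < a]].

Definition lambda_max A : \bar R :=
  ereal_sup [set a%:E | a in [set a : R | eigenvalue A a]].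

End Spectrum.

Record params (R : realType) := Params {
  Lx : R; Ly : R; Lxy : R; mux : R; muy : R; muxy : R; muyx : R }.

Section Constants.
Variables (R : realType) (par : params R).

Definition admissible : Prop :=
  [/\ Lx par > mux par /\ mux par >= 0,
      Ly par > muy par /\ muy par >= 0,
      Lxy par > muxy par /\ muxy par >= 0,
      Lxy par > muyx par /\ muyx par >= 0
    & 0 < muxy par -> 0 < muyx par -> muxy par = muyx par].

Definition delta_x : R := mux par + muxy par ^+ 2 / Ly par.
Definition delta_y : R := muy par + muyx par ^+ 2 / Lx par.
Definition kappa_x : R := Lx par / delta_x.
Definition kappa_y : R := Ly par / delta_y.
Definition kappa_xy : R := Lxy par ^+ 2 / (delta_x * delta_y).

End Constants.

Section Problem.
Variables (R : realType) (dx dy : nat).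
Variables (f : 'cV[R]_dx -> R) (g : 'cV[R]_dy -> R) (B : 'M[R]_(dy, dx)).

Definition regular (par : params R) : Prop :=
  [/\ (forall x, differentiable f x) /\ (forall y, differentiable g y),
      [/\ strongly_convex 0 f, strongly_convex (mux par) f & smooth (Lx par) f],
      [/\ strongly_convex 0 g, strongly_convex (muy par) g & smooth (Ly par) g],
      (let grad_in_range := forall x, range (mulmx B^T) (grad f x) in
       (grad_in_range ->
          ((muxy par ^+ 2)%:E <= lambda_min_pos (B^T *m B))%E) /\
       (~ grad_in_range ->
          ((muxy par ^+ 2)%:E <= lambda_min (B^T *m B))%E)) /\
      (let grad_in_range := forall y, range (mulmx B) (grad g y) in
       (grad_in_range ->
          ((muyx par ^+ 2)%:E <= lambda_min_pos (B *m B^T))%E) /\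
       (~ grad_in_range ->
          ((muyx par ^+ 2)%:E <= lambda_min (B *m B^T))%E))
    & (lambda_max (B^T *m B) <= (Lxy par ^+ 2)%:E)%E].

Definition primal (x : 'cV[R]_dx) : \bar R :=
  ((f x)%:E + conjugate g (B *m x))%E.

Definition dual (y : 'cV[R]_dy) : \bar R :=
  ((- g y)%:E - conjugate f (- (B^T *m y)))%E.

Definition Sx : set 'cV[R]_dx :=
  [set x | forall x', (primal x <= primal x')%E].

Definition Sy : set 'cV[R]_dy :=
  [set y | forall y', (dual y' <= dual y)%E].

(* +oo if A is empty; attained if A is closed and nonempty *)
Definition dist (d : nat) (x : 'cV[R]_d) (A : set 'cV[R]_d) : \bar R :=
  ereal_inf [set (enorm (x - x'))%:E | x' in A].

Definition Rsq (dex dey : R) (x : 'cV[R]_dx) (y : 'cV[R]_dy) : \bar R :=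
  (dex%:E * dist x Sx ^+ 2 + dey%:E * dist y Sy ^+ 2)%E.

End Problem.

(* Levels and indices 1, ..., n are the elements 0, ..., n-1 of 'I_n.
   The points z^i_{t_1, ..., t_i} are kept in registers: [reg s i] holds the
   most recently defined point of the family z^i.  Step 6 and the initialization
   only rename the current content of a register.
   [ngrad s i] and [nQ s i] count the computations of the gradient of p_i and of
   Q_i made so far. *)
Section Algorithm.
Variables (R : realType) (d n : nat).
Local Notation Z := 'cV[R]_d.

Fixpoint alpha (t : nat) : R :=
  if t is t'.+1 then 2 * (1 + Num.sqrt (1 + 4 / alpha t' ^+ 2))^-1 else 1.

Definition argmin (C : set Z) (F : Z -> R) : Z :=
  xget 0 [set z | C z /\ forall w, C w -> F z <= F w].

Record state := State {
  reg : 'I_n -> Z; ngrad : 'I_n -> nat; nQ : 'I_n -> nat }.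

Variables (p : 'I_n -> Z -> R) (Q : 'I_n -> Z -> Z) (C : set Z).
Variables (L M : 'I_n -> R) (T : 'I_n -> nat) (Pm : 'M[R]_d).

(* [ts] is the list t_1, ..., t_k where k is the current level. *)
Definition Hcoef (k : 'I_n) (ts : seq nat) : R :=
  L k * \prod_(l < n | (l <= k)%N) alpha (nth 0%N ts l)
  + M k * \prod_(l < n | (l <= k)%N) (alpha (nth 0%N ts l) / alpha (T l).-1).

Definition phat (k : 'I_n) (t : nat) (q : 'I_n -> Z -> R) (zbar : Z)
    (i : 'I_n) : Z -> R :=
  if (k <= i)%N
  then fun z => (alpha t)^-1 * q i (alpha t *: z + (1 - alpha t) *: zbar)
  else q i.

Definition linearized (H : R) (zk Delta : Z) : Z -> R :=
  fun z => H / 2 * mxnorm_of Pm (z - zk) ^+ 2 + dot z Delta.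

(* One loop iteration of level k: [rec] is Rec(k+1; .), [ts] is t_1, ..., t_(k-1)
   and [q i] is p_i^(k-1; t_1, ..., t_(k-1)).  Q_k is computed at z^k for Delta_k
   (and reused afterwards) and at the point returned by the recursive call. *)
Definition level_step
    (rec : seq nat -> ('I_n -> Z -> R) -> state -> Z * state)
    (k : 'I_n) (ts : seq nat) (q : 'I_n -> Z -> R)
    (acc : Z * state) (t : nat) : Z * state :=
  let: (zbar, s) := acc in
  let ts' := rcons ts t in
  let H := Hcoef k ts' in
  let zk := reg s k in
  let ph := phat k t q zbar in
  let Delta := grad (ph k) zk + Q k zk in
  let q' := [eta ph with k |-> linearized H zk Delta] in
  let s1 := State (reg s) [eta ngrad s with k |-> (ngrad s k).+1]
                          [eta nQ s with k |-> (nQ s k).+1] in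
  let: (zhalf, s2) := rec ts' q' s1 in
  let DeltaQ := Q k zk - Q k zhalf in
  let znext := zhalf + invmx (H *: Pm) *m DeltaQ in
  (alpha t *: zhalf + (1 - alpha t) *: zbar,
   State [eta reg s2 with k |-> znext] (ngrad s2)
         [eta nQ s2 with k |-> (nQ s2 k).+1]).

(* [ks] lists the levels k, ..., n that remain; it is empty at level n+1. *)
Fixpoint Rec (ks : seq 'I_n) (ts : seq nat) (q : 'I_n -> Z -> R) (s : state) :
    Z * state :=
  if ks is k :: ks' then
    foldl (level_step (Rec ks') k ts q) (reg s k, s) (iota 0 (T k))
  else (argmin C (fun z => \sum_i q i z), s).

Definition algorithm1 (zin : Z) : Z * state :=
  Rec (enum 'I_n) [::] p (State (fun=> zin) (fun=> 0%N) (fun=> 0%N)).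

End Algorithm.

Section Instance.
Variables (R : realType) (dx dy : nat).
Variables (f : 'cV[R]_dx -> R) (g : 'cV[R]_dy -> R) (B : 'M[R]_(dy, dx)).
Variable par : params R.
Local Notation Z := 'cV[R]_(dx + dy).

Definition triple (A : Type) (a1 a2 a3 : A) (i : 'I_3) : A :=
  nth a1 [:: a1; a2; a3] i.

Definition idx_f : 'I_3 := @Ordinal 3 0 isT.
Definition idx_g : 'I_3 := @Ordinal 3 1 isT.
Definition idx_B : 'I_3 := @Ordinal 3 2 isT.

(* z = (x, y) is col_mx x y, with x = usubmx z and y = dsubmx z. *)
Definition inst_p (zin : Z) : 'I_3 -> Z -> R :=
  triple (fun z => f (usubmx z))
         (fun z => g (dsubmx z))
         (fun z =>
            (8 * Ly par)^-1 *
              enorm (B *m usubmx z - grad g (dsubmx zin)) ^+ 2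
            + (8 * Lx par)^-1 *
              enorm (B^T *m dsubmx z + grad f (usubmx zin)) ^+ 2).

Definition inst_Q : 'I_3 -> Z -> Z :=
  triple (fun=> 0) (fun=> 0)
         (fun z => col_mx (B^T *m dsubmx z) (- (B *m usubmx z))).

Definition inst_L : 'I_3 -> R :=
  triple (kappa_x par) (kappa_y par) (kappa_xy par).

Definition inst_M : 'I_3 -> R := triple 0 0 (Num.sqrt (kappa_xy par)).

Definition inst_P : 'M[R]_(dx + dy) :=
  block_mx (delta_x par)%:M 0 0 (delta_y par)%:M.

(* An order of the three pairs (level k of the algorithm processes the pair of
   index [c.1 k]) together with the numbers of iterations T_k of the levels. *)
Definition schedule := ({perm 'I_3} * ('I_3 -> nat))%type.

Definition run (zin : Z) (c : schedule) : Z * state R (dx + dy) 3 :=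
  algorithm1 (inst_p zin \o c.1) (inst_Q \o c.1) [set: Z]
             (inst_L \o c.1) (inst_M \o c.1) c.2 inst_P zin.

Definition run_ngrad (zin : Z) (c : schedule) (i : 'I_3) : nat :=
  ngrad (run zin c).2 ((c.1^-1)%g i).

Definition run_nQ (zin : Z) (c : schedule) (i : 'I_3) : nat :=
  nQ (run zin c).2 ((c.1^-1)%g i).

Definition tol : R := 72%:R^-1.

Definition valid_schedule (zin : Z) (c : schedule) : Prop :=
  let zout := (run zin c).1 in
  let ptot z := \sum_i inst_p zin i z in
  let Qtot z := \sum_i inst_Q i z in
  let budget i := 6 ^+ 3 * Num.max (Num.sqrt (inst_L i / tol))
                             (Num.max (inst_M i / tol) 1) in
  [/\ forall k, (0 < c.2 k)%N,
      forall z, ptot zout - ptot z + dot (Qtot z) (zout - z)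
                <= 3 * tol * mxnorm_of inst_P (zin - z) ^+ 2
    & forall i, (run_ngrad zin c i)%:R <= budget i /\
                (run_nQ zin c i)%:R <= budget i].

Fixpoint restarted (c : nat -> schedule) (t : nat) : Z :=
  if t is t'.+1 then (run (restarted c t') (c t')).1 else 0.

(* Oracle calls of N restarts.  Each restart computes grad f(x^t) and grad g(y^t)
   once, to form p_3.  Since
     grad p_3 (x, y) = ((4 L_y)^-1 B^T (B x - grad g(y^t)),
                        (4 L_x)^-1 B (B^T y + grad f(x^t))),
   a computation of grad p_3 takes four multiplications by B or B^T, and one of
   Q_3 takes two. *)
Definition count_grad_f (c : nat -> schedule) (N : nat) : nat :=
  \sum_(t < N) (run_ngrad (restarted c t) (c t) idx_f + 1).

Definition count_grad_g (c : nat -> schedule) (N : nat) : nat :=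
  \sum_(t < N) (run_ngrad (restarted c t) (c t) idx_g + 1).

Definition count_matvec (c : nat -> schedule) (N : nat) : nat :=
  \sum_(t < N) (4 * run_ngrad (restarted c t) (c t) idx_B
                + 2 * run_nQ (restarted c t) (c t) idx_B).

Definition valid_schedules (c : nat -> schedule) : Prop :=
  forall t, valid_schedule (restarted c t) (c t).

End Instance.

(* Main.v *)
(* In the norm of P the components of Algorithm 1 are kappa_x-, kappa_y- and kappa_xy-smooth, and
   Q_3 is sqrt kappa_xy-Lipschitz.  By induction on the levels, from the innermost one outwards,
   the point returned by Rec(k) satisfies, for every z, a gap inequality whose right-hand side
   telescopes in the squared distances from z to the registers: one loop iteration is an
   extragradient step, and the weights alpha_t turn the loop into an accelerated method.  At
   the outermost level the constant of component i is governed by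
   alpha_(T_1 - 1) ... alpha_(T_i - 1), which is of order 1 / (T_1 ... T_i); sorting the components
   by their budgets yields the required T_k.

   For the linear convergence, a saddle point (xs, ys) exists because the optimality field, multiplied
   by a suitable invertible matrix, is strongly monotone and Lipschitz on the ranges of projections
   Pix, Piy along the directions in which the problem is degenerate; moreover
   dist(x, S_x) = |Pix (x - xs)|, and likewise for y.  Testing the gap
   inequality at the solution nearest to the input shows that the potential
   D_f(x, xs) + D_g(y, ys) + R^2(x, y) / 14 decreases by the factor 2/3 at each restart, where p_3
   contributes the part of R^2 that comes from mu_xy and mu_yx. *)

Require Import Defs.
Set Warnings "-notation-overridden,-ambiguous-paths,-notation-incompatible-prefix".
From mathcomp Require Import all_boot all_order all_algebra all_fingroup.
From mathcomp Require Import all_classical all_reals all_analysis.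
From mathcomp Require Import ring lra zify.
Import Order.TTheory GRing.Theory Num.Theory numFieldNormedType.Exports.
Local Open Scope classical_set_scope.
Local Open Scope ring_scope.
Set Implicit Arguments.
Unset Strict Implicit.

(** * Euclidean geometry and symmetric matrices *)

Section Dot.
Variables (R : realType) (d : nat).
Implicit Types (u v w : 'cV[R]_d) (a : R).

(** The squared distance alone is not the quantity to track. The data of [p_3] are gradients at the
    input, standing for the unknown [B *m xs] and [- (B^T *m ys)]; by cocoercivity their error is
    bounded by the Bregman distances of the input to the saddle point, so these must be part of what
    decreases. They are at most of order [kappa] times the squared distance, a loss incurred once,
    at the starting point: hence the factor c inside the logarithm. Since the solution sets may be
    whole affine subspaces, [f] and [B] are shown to be blind to the directions killed by [Pix], and
    [g] and [B^T] to those killed by [Piy]; the lower bounds [muxy] and [muyx] concern only what the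
    projections keep. In the analysis of one run, smoothness is a two-sided inequality with some
    vector field as witness. This form is stable under the rescaling of every level, and the witness
    is identified with [grad] afterwards. The spectral hypotheses enter as Rayleigh inequalities,
    obtained from a supremum instead of a diagonalization. *)

Lemma dotC u v : dot u v = dot v u.
Proof. by apply: eq_bigr => i _; rewrite mulrC. Qed.

Lemma dotDl u v w : dot (u + v) w = dot u w + dot v w.
Proof. by rewrite /dot -big_split; apply: eq_bigr => i _; rewrite mxE mulrDl. Qed.

Lemma dotZl a u v : dot (a *: u) v = a * dot u v.
Proof. by rewrite /dot mulr_sumr; apply: eq_bigr => i _; rewrite mxE mulrA. Qed.

Lemma dotNl u v : dot (- u) v = - dot u v.
Proof. by rewrite -scaleN1r dotZl mulN1r. Qed.

Lemma dotDr u v w : dot u (v + w) = dot u v + dot u w.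
Proof. by rewrite dotC dotDl !(dotC u). Qed.

Lemma dotZr a u v : dot u (a *: v) = a * dot u v.
Proof. by rewrite dotC dotZl dotC. Qed.

Lemma dotNr u v : dot u (- v) = - dot u v.
Proof. by rewrite dotC dotNl dotC. Qed.

Lemma dot0l u : dot 0 u = 0.
Proof. by rewrite -(scale0r 0) dotZl mul0r. Qed.

Lemma dot0r u : dot u 0 = 0.
Proof. by rewrite dotC dot0l. Qed.

Lemma dot_suml (I : Type) (r : seq I) (P : pred I) (F : I -> 'cV[R]_d) u :
  dot (\sum_(i <- r | P i) F i) u = \sum_(i <- r | P i) dot (F i) u.
Proof. exact: (big_morph (fun v => dot v u) (fun v w => dotDl v w u) (dot0l u)). Qed.

Definition dotE := (dotDl, dotDr, dotNl, dotNr, dotZl, dotZr, dot0l, dot0r).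

Lemma dot_ge0 u : 0 <= dot u u.
Proof. by apply: sumr_ge0 => i _; rewrite -expr2 sqr_ge0. Qed.

Lemma dot_eq0 u : (dot u u == 0) = (u == 0).
Proof.
apply/idP/eqP => [|->]; last by rewrite dot0l.
rewrite psumr_eq0 => [/allP u0|i _]; last by rewrite -expr2 sqr_ge0.
apply/matrixP => i j; rewrite (ord1 j) mxE; apply/eqP.
by have := u0 i (mem_index_enum _); rewrite /= mulf_eq0 orbb.
Qed.

Lemma dot_gt0 u : (0 < dot u u) = (u != 0).
Proof. by rewrite lt0r dot_eq0 dot_ge0 andbT. Qed.

Lemma enorm_sqr u : enorm u ^+ 2 = dot u u.
Proof. by rewrite sqr_sqrtr ?dot_ge0. Qed.

Lemma enorm_ge0 u : 0 <= enorm u.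
Proof. exact: sqrtr_ge0. Qed.

Lemma dot_delta u i : dot u (delta_mx i 0) = u i 0.
Proof.
rewrite /dot (bigD1 i) //= mxE !eqxx mulr1 big1 ?addr0 // => j ji.
by rewrite mxE (negPf ji) mulr0.
Qed.

(** Only the existence of the constant matters, so the sum of the absolute entries is enough; the
    summand 1 keeps it positive for the zero matrix, because it gets inverted later. *)
Lemma dot_mulmx_bounded (A : 'M[R]_d) :
  exists2 K : R, 0 < K & forall v, `|dot (A *m v) v| <= K * dot v v.
Proof.
exists (1 + \sum_i \sum_j `|A i j|) => [|v].
  by rewrite ltr_pwDl // sumr_ge0 // => i _; rewrite sumr_ge0.
rewrite mulrDl mul1r; apply: ler_wpDl; first exact: dot_ge0.
rewrite mulr_suml; apply: le_trans (ler_norm_sum _ _ _) _; apply: ler_sum => i _.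
rewrite mxE !mulr_suml; apply: le_trans (ler_norm_sum _ _ _) _.
apply: ler_sum => j _; rewrite -mulrA normrM ler_wpM2l //.
have coord_le k : `|v k 0| ^+ 2 <= dot v v.
  rewrite real_normK ?num_real // /dot (bigD1 k) //= expr2 lerDl.
  by apply: sumr_ge0 => l _; rewrite -expr2 sqr_ge0.
have := coord_le i; have := coord_le j; rewrite normrM.
have := sqr_ge0 (`|v j 0| - `|v i 0|); nra.
Qed.

End Dot.

Lemma dot_trmx (R : realType) (m n : nat) (A : 'M[R]_(m, n)) u v :
  dot (A *m u) v = dot u (A^T *m v).
Proof.
transitivity (\sum_i \sum_j A i j * u j 0 * v i 0).
  by apply: eq_bigr => i _; rewrite mxE mulr_suml.
rewrite exchange_big; apply: eq_bigr => j _ /=; rewrite mxE mulr_sumr.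
by apply: eq_bigr => i _; rewrite mxE; ring.
Qed.

Section Symmetric.
Variables (R : realType) (d : nat).
Implicit Types A : 'M[R]_d.

Lemma psd_cauchy_schwarz A u v :
  A^T = A -> (forall w, 0 <= dot (A *m w) w) ->
  dot (A *m u) v ^+ 2 <= dot (A *m u) u * dot (A *m v) v.
Proof.
move=> symA psdA.
have expand a b : 0 <= a ^+ 2 * dot (A *m u) u + 2 * a * b * dot (A *m u) v
                        + b ^+ 2 * dot (A *m v) v.
  have := psdA (a *: u + b *: v).
  rewrite mulmxDr -!scalemxAr !dotE (dot_trmx A v u) symA (dotC v).
  by congr (0 <= _); ring.
have := psdA u; rewrite le_eqVlt => /predU1P[uu0|uu_gt0].
  (* When the form vanishes at [u], these coefficients reduce the expansion to minus the square of
     [dot (A *m u) v]. *)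
  have := expand (- (dot (A *m v) v + 1) / 2) (dot (A *m u) v).
  rewrite -uu0; have := psdA v; move: (dot (A *m v) v) (dot (A *m u) v) => y x; nra.
have := expand (- dot (A *m u) v) (dot (A *m u) u).
move: (dot (A *m v) v) (dot (A *m u) v) (dot (A *m u) u) uu_gt0 => y x z z0 H.
by rewrite -(ler_pM2l z0); nra.
Qed.

Lemma cauchy_schwarz (u v : 'cV[R]_d) : dot u v ^+ 2 <= dot u u * dot v v.
Proof.
have := @psd_cauchy_schwarz 1%:M u v; rewrite !mul1mx trmx1; apply=> // w.
by rewrite mul1mx dot_ge0.
Qed.

(** Cauchy-Schwarz for the form of [A], applied to [v] and [invmx A *m v], bounds [dot v v ^+ 2] by
    [dot (A *m v) v] times the form of the inverse, which is bounded. *)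
Lemma psd_unitmx_coercive A :
  A^T = A -> (forall w, 0 <= dot (A *m w) w) -> A \in unitmx ->
  exists2 c : R, 0 < c & forall v, c * dot v v <= dot (A *m v) v.
Proof.
move=> symA psdA unitA; have [K K0 Kle] := dot_mulmx_bounded (invmx A).
exists K^-1 => [|v]; first by rewrite invr_gt0.
have := psd_cauchy_schwarz v (invmx A *m v) symA psdA.
rewrite mulKVmx // dot_trmx symA mulKVmx // => vv.
have vw : dot v (invmx A *m v) <= K * dot v v.
  by rewrite dotC; apply: le_trans (ler_norm _) (Kle v).
rewrite ler_pdivrMl // mulrC.
have := psdA v; have := dot_ge0 v; rewrite le_eqVlt => /predU1P[<-|v0] Av.
  by rewrite mulr_ge0 // ltW.
rewrite -(ler_pM2r v0) -expr2; apply: le_trans vv _.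
by rewrite -mulrA ler_wpM2l.
Qed.

(* The infimum s of the Rayleigh quotient is an eigenvalue, since A - s is positive
   semidefinite and, were it invertible, it would be coercive. *)
Lemma rayleigh_ge A m :
  A^T = A -> (forall a, eigenvalue A a -> m <= a) ->
  forall v, m * dot v v <= dot (A *m v) v.
Proof.
move=> symA eigA v; rewrite leNgt; apply/negP => v_lt.
pose S := [set c : R | forall w, c * dot w w <= dot (A *m w) w].
have v0 : 0 < dot v v.
  by rewrite dot_gt0; apply: contraTneq v_lt => ->; rewrite mulmx0 !dot0l mulr0 ltxx.
have [K K0 Kle] := dot_mulmx_bounded A.
have ubS w c : 0 < dot w w -> S c -> c <= dot (A *m w) w / dot w w.
  by move=> w0 Sc; rewrite ler_pdivlMr.
have S0 : S !=set0.
  exists (- K) => w; rewrite mulNr lerNl; apply: le_trans (Kle w).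
  by rewrite -normrN ler_norm.
have supS : has_sup S.
  by split=> //; exists (dot (A *m v) v / dot v v) => c; apply: ubS.
have Ssup : S (sup S).
  move=> w; have := dot_ge0 w; rewrite le_eqVlt => /predU1P[w0|w0].
    rewrite -w0 mulr0; have /esym/eqP := w0.
    by rewrite dot_eq0 => /eqP->; rewrite mulmx0 dot0l.
  by rewrite -ler_pdivlMr //; apply: ge_sup => // c; apply: ubS.
pose B := A - (sup S)%:M.
have dotB w : dot (B *m w) w = dot (A *m w) w - sup S * dot w w.
  by rewrite mulmxBl mul_scalar_mx !dotE.
have [c c0 cle] : exists2 c : R, 0 < c & forall w, c * dot w w <= dot (B *m w) w.
  apply: psd_unitmx_coercive => [|w|].
  - by rewrite /B linearB /= symA tr_scalar_mx.
  - by rewrite dotB subr_ge0.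
  rewrite -row_free_unit -kermx_eq0; apply: contraTT v_lt => eig.
  by rewrite -leNgt (le_trans _ (Ssup v)) // ler_wpM2r ?dot_ge0 // eigA.
have : S (sup S + c) by move=> w; have := cle w; rewrite dotB; lra.
by move=> /(ub_le_sup supS.2); rewrite gerDl leNgt c0.
Qed.

Lemma rayleigh_le A m :
  A^T = A -> (forall a, eigenvalue A a -> a <= m) ->
  forall v, dot (A *m v) v <= m * dot v v.
Proof.
move=> symA eigA v; have := @rayleigh_ge (- A) (- m); rewrite linearN /= symA.
move=> /(_ erefl) H; have := H _ v; rewrite mulNmx !dotE mulNr lerN2; apply=> a.
move=> /eigenvalueP[w wA w0]; rewrite lerNl; apply: eigA; apply/eigenvalueP.
by exists w => //; rewrite scaleNr -wA mulmxN opprK.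
Qed.

End Symmetric.

(** * One run of Algorithm 1 *)

(** A quadratic remainder forces every directional difference quotient to converge at a linear rate,
    which identifies [grad] without any rule of differentiation. *)
Lemma grad_unique (R : realType) (d : nat) (h : 'cV[R]_d -> R) (z u : 'cV[R]_d) (K : R) :
  (forall w, `|h w - h z - dot u (w - z)| <= K * dot (w - z) (w - z)) ->
  grad h z = u.
Proof.
move=> hK; apply/matrixP => i j; rewrite (ord1 j) mxE; apply: cvg_lim => //.
apply/subr_cvg0; apply: (@cvg_to_0_linear _ _ K 1) => // t /andP[t0 _].
have := hK (t *: delta_mx i 0 + z); rewrite addrK !dotE !dot_delta mxE !eqxx mulr1 => bnd.
rewrite normr_gt0 in t0; rewrite -(ler_pM2l (x := `|t|)) ?normr_gt0 // -normrM.
rewrite mulrCA -expr2 real_normK ?num_real //.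
congr (_ <= _): bnd; first by congr `|_|; rewrite /= /GRing.scale /=; field.
Qed.

(** * The weights alpha_t *)

Section Alpha.
Variable R : realType.
Local Notation alpha := (alpha R).

Lemma alpha_gt0 t : 0 < alpha t.
Proof.
by case: t => [|t] //=; rewrite mulr_gt0 // invr_gt0 ltr_pwDl ?sqrtr_ge0.
Qed.

Lemma alphaS_inv t :
  (alpha t.+1)^-1 = (1 + Num.sqrt (1 + 4 * (alpha t)^-1 ^+ 2)) / 2.
Proof.
rewrite /= exprVn; set s := Num.sqrt _; have s0 : 0 <= s by exact: sqrtr_ge0.
by field; lra.
Qed.

(** The inverse of [alpha t.+1] is the positive root of [x ^+ 2 - x = (alpha t)^-1 ^+ 2]. *)
Lemma alphaS_rec t : (1 - alpha t.+1) / alpha t.+1 ^+ 2 = (alpha t ^+ 2)^-1.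
Proof.
have a0 := alpha_gt0 t.+1; have b0 := alpha_gt0 t.
transitivity ((alpha t.+1)^-1 ^+ 2 - (alpha t.+1)^-1); first by field; lra.
rewrite alphaS_inv; set x := Num.sqrt _.
have x2 : x ^+ 2 = 1 + 4 * (alpha t)^-1 ^+ 2.
  by rewrite sqr_sqrtr // addr_ge0 // mulr_ge0 // sqr_ge0.
rewrite exprMn sqrrD x2 -exprVn; field; lra.
Qed.

Lemma alpha_inv_incr t : (alpha t)^-1 + 2^-1 <= (alpha t.+1)^-1.
Proof.
rewrite alphaS_inv; set x := (alpha t)^-1.
have x0 : 0 < x by rewrite invr_gt0 alpha_gt0.
have : 2 * x <= Num.sqrt (1 + 4 * x ^+ 2).
  have x2 := sqr_ge0 x; rewrite -(ler_pXn2r (n := 2)) ?nnegrE ?sqrtr_ge0 //; last lra.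
  by rewrite sqr_sqrtr ?exprMn; lra.
by lra.
Qed.

Lemma alpha_nonincreasing t u : (t <= u)%N -> alpha u <= alpha t.
Proof.
elim: u => [|u IH]; first by rewrite leqn0 => /eqP->.
rewrite leq_eqVlt ltnS => /predU1P[->//|/IH]; apply: le_trans.
by rewrite -lef_pV2 ?posrE ?alpha_gt0 //; have := alpha_inv_incr u; lra.
Qed.

Lemma alpha_le1 t : alpha t <= 1.
Proof. exact: (alpha_nonincreasing (leq0n t)). Qed.

Lemma alpha_le t : alpha t <= 2 / t.+2%:R.
Proof.
rewrite -[leLHS]invrK -[leRHS]invf_div lef_pV2 ?posrE ?divr_gt0 ?invr_gt0 ?alpha_gt0 //.
elim: t => [|t IH]; first by rewrite /= invr1 divff.
by have := alpha_inv_incr t; move: IH; rewrite -[in t.+3%:R]natr1; lra.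
Qed.

End Alpha.

Ltac colring := apply/matrixP => ? ?; rewrite !mxE; ring.

(** * Convex, smooth and quadratic functions in the norm of P *)

Section Quadratic.
Variables (R : realType) (d : nat) (Pm : 'M[R]_d).
Hypothesis symP : Pm^T = Pm.
Hypothesis pdP : forall u, u != 0 -> 0 < dot (Pm *m u) u.
Implicit Types (z w u v : 'cV[R]_d) (q : 'cV[R]_d -> R).

Definition pdot u v := dot (Pm *m u) v.
Definition sqn u := pdot u u.

Lemma pdotC u v : pdot u v = pdot v u.
Proof. by rewrite /pdot dot_trmx symP dotC. Qed.

Lemma pdotDl u v w : pdot (u + v) w = pdot u w + pdot v w.
Proof. by rewrite /pdot mulmxDr dotDl. Qed.

Lemma pdotZl a u v : pdot (a *: u) v = a * pdot u v.
Proof. by rewrite /pdot -scalemxAr dotZl. Qed.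

Lemma pdotNl u v : pdot (- u) v = - pdot u v.
Proof. by rewrite /pdot mulmxN dotNl. Qed.

Lemma pdotDr u v w : pdot w (u + v) = pdot w u + pdot w v.
Proof. exact: dotDr. Qed.

Lemma pdotZr a u v : pdot v (a *: u) = a * pdot v u.
Proof. exact: dotZr. Qed.

Lemma pdotNr u v : pdot v (- u) = - pdot v u.
Proof. exact: dotNr. Qed.

Definition pdotE := (pdotDl, pdotDr, pdotNl, pdotNr, pdotZl, pdotZr).

Lemma sqn_ge0 u : 0 <= sqn u.
Proof.
by have [->|/pdP/ltW//] := eqVneq u 0; rewrite /sqn /pdot dot0r.
Qed.

Lemma mxnorm_of_sqr u : mxnorm_of Pm u ^+ 2 = sqn u.
Proof. by rewrite sqr_sqrtr // sqn_ge0. Qed.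

Lemma sqnN u : sqn (- u) = sqn u.
Proof. by rewrite /sqn !pdotE opprK. Qed.

Lemma pd_unitmx : Pm \in unitmx.
Proof.
rewrite -row_free_unit -kermx_eq0; apply/negPn/negP => /rowV0Pn[v].
move=> /sub_kermxP vP v0; have := pdP (u := v^T); rewrite trmx_eq0 => /(_ v0).
by rewrite -[Pm]trmxK -trmx_mul symP vP trmx0 dot0l ltxx.
Qed.

Definition convex_fun q := forall z w t, 0 <= t <= 1 ->
  q (t *: z + (1 - t) *: w) <= t * q z + (1 - t) * q w.

(** The gradient is an existential witness, so that rescaling needs no differentiation;
    [convex_smooth_grad] recovers [grad]. *)
Definition convex_smooth l q := exists G, forall z w,
  0 <= q w - q z - dot (G z) (w - z) <= l / 2 * sqn (w - z).

(** An equality, because the functions left at the innermost level are of this kind and their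
    minimum is evaluated exactly. *)
Definition quadratic h q := exists G, forall z w,
  q w - q z - dot (G z) (w - z) = h / 2 * sqn (w - z).

Lemma subgradient_convex q G :
  (forall z w, 0 <= q w - q z - dot (G z) (w - z)) -> convex_fun q.
Proof.
move=> qG z w t /andP[t0 t1]; set v := t *: z + _.
have := qG v z; have := qG v w.
have -> : z - v = (1 - t) *: (z - w) by rewrite /v; colring.
have -> : w - v = - t *: (z - w) by rewrite /v; colring.
by rewrite !dotZr; nra.
Qed.

Lemma convex_smooth_convex l q : convex_smooth l q -> convex_fun q.
Proof. by case=> G qG; apply: (@subgradient_convex _ G) => z w; case/andP: (qG z w). Qed.

Lemma quadratic_convex h q : 0 <= h -> quadratic h q -> convex_fun q.
Proof.
move=> h0 [G qG]; apply: (@subgradient_convex _ G) => z w.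
by rewrite qG mulr_ge0 ?sqn_ge0 ?divr_ge0.
Qed.

Lemma convex_smooth_grad l q : convex_smooth l q ->
  forall z w, 0 <= q w - q z - dot (grad q z) (w - z) <= l / 2 * sqn (w - z).
Proof.
case=> G qG z w; have [K K0 Kle] := dot_mulmx_bounded Pm.
suff -> : grad q z = G z by [].
apply: (@grad_unique _ _ _ _ _ (`|l / 2| * K)) => v.
have /andP[q0 ql] := qG z v; rewrite ger0_norm // (le_trans ql) // -[leRHS]mulrA.
apply: le_trans (_ : `|l / 2| * sqn (v - z) <= _).
  by rewrite ler_wpM2r ?sqn_ge0 // ler_norm.
by rewrite ler_wpM2l // (le_trans _ (Kle _)) // ler_norm.
Qed.

(** Scaling the argument multiplies the quadratic bound by [a ^+ 2] and the prefactor divides it by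
    [a]: each level therefore multiplies [L i] by one more [alpha]. *)
Lemma convex_smooth_rescale l q a b : 0 < a -> convex_smooth l q ->
  convex_smooth (l * a) (fun z => a^-1 * q (a *: z + b)).
Proof.
move=> a0 [G qG]; exists (fun z => G (a *: z + b)) => z w.
have := qG (a *: z + b) (a *: w + b).
have -> : a *: w + b - (a *: z + b) = a *: (w - z) by colring.
rewrite dotZr {1}/sqn pdotZl pdotZr -/(sqn _) /=.
move: (sqn _) (dot _ _) (q (a *: w + b)) (q (a *: z + b)) => s x y y' H.
have -> : a^-1 * y - a^-1 * y' - x = (y - y' - a * x) / a by field; lra.
case/andP: H => H1 H2; rewrite divr_ge0 ?(ltW a0) //= ler_pdivrMr //.
by apply: le_trans H2 _; rewrite le_eqVlt; apply/orP; left; apply/eqP; ring.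
Qed.

Lemma sqn_convex : convex_fun sqn.
Proof.
apply: (@quadratic_convex 2); first lra.
exists (fun z => 2 *: (Pm *m z)) => z w.
rewrite dotZl -/(pdot z (w - z)) /sqn !pdotE (pdotC z w); lra.
Qed.

Lemma quadratic_linearized H zk D : quadratic H (linearized Pm H zk D).
Proof.
exists (fun z => H *: (Pm *m (z - zk)) + D) => z w.
rewrite /linearized !mxnorm_of_sqr !dotDl dotZl -/(pdot _ _) /sqn !pdotE !dotE.
rewrite (dotC z D) (dotC w D) (pdotC z zk) (pdotC w zk) (pdotC w z); lra.
Qed.

Lemma quadratic_sum (I : finType) (h : I -> R) (q : I -> 'cV[R]_d -> R) :
  (forall i, quadratic (h i) (q i)) ->
  quadratic (\sum_i h i) (fun z => \sum_i q i z).
Proof.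
move=> /choice[G qG]; exists (fun z => \sum_i G i z) => z w.
rewrite mulr_suml mulr_suml -!sumrB.
rewrite dot_suml.
by rewrite -sumrB; apply: eq_bigr => i _; apply: qG.
Qed.

(** [argmin] is an [xget], meaningful only once a minimizer is exhibited; this is the zero [w] of
    the gradient field, and positive definiteness makes it the only one. *)
Lemma quadratic_argmin h q z : 0 < h -> quadratic h q ->
  q (argmin [set: 'cV[R]_d] q) - q z = - (h / 2 * sqn (argmin [set: 'cV[R]_d] q - z)).
Proof.
move=> h0 [G qG]; set zm := argmin _ q.
have [w Gw0] : exists w, G w = 0.
  have [w Pw] : exists w, Pm *m w = - (h^-1 *: G 0).
    exists (- (h^-1 *: (invmx Pm *m G 0))).
    by rewrite mulmxN -scalemxAr mulKVmx // pd_unitmx.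
  have qE v : q v = q 0 + dot (G 0) v + h / 2 * sqn v.
    by have := qG 0 v; rewrite subr0; lra.
  have dotGw v : dot (G w) (v - w) = 0.
    have := qG w v; rewrite (qE v) (qE w) /sqn !pdotE.
        have -> : pdot v w = - (h^-1 * dot (G 0) v).
      by rewrite pdotC /pdot Pw dotNl dotZl.
    have -> : pdot w v = - (h^-1 * dot (G 0) v).
      by rewrite /pdot Pw dotNl dotZl.
    have -> : pdot w w = - (h^-1 * dot (G 0) w).
      by rewrite /pdot Pw dotNl dotZl.
    have hV x : h / 2 * (h^-1 * x) = x / 2 by field; lra.
    by have := hV (dot (G 0) v); have := hV (dot (G 0) w); lra.
  (* [G] is known only through its defining identity; [dotGw] makes [G w] orthogonal to every
     vector, in particular to itself. *)
  by exists w; have := dotGw (G w + w); rewrite addrK => /eqP; rewrite dot_eq0 => /eqP.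
have qw v : q v = q w + h / 2 * sqn (v - w).
  by have := qG w v; rewrite Gw0 dot0l; lra.
have zmw : zm = w.
  have [_ zm_min] : [set: 'cV[R]_d] zm /\ forall v, [set: 'cV[R]_d] v -> q zm <= q v.
    apply: (@xgetPex _ 0 [set z | setT z /\ forall v, setT v -> q z <= q v]).
    by exists w; split=> // v _; rewrite [leRHS]qw lerDl mulr_ge0 ?sqn_ge0 ?divr_ge0 ?ltW.
  apply/eqP; rewrite -subr_eq0; apply: contraTT (zm_min w I) => zw.
  by rewrite -ltNge [ltRHS]qw ltrDl mulr_gt0 ?divr_gt0 // pdP.
by rewrite zmw (qw z) -(opprB w z) sqnN; ring.
Qed.

End Quadratic.

Lemma drop_enum_ord (n j : nat) (k : 'I_n) ks :
  drop j (enum 'I_n) = k :: ks -> j = k /\ drop j.+1 (enum 'I_n) = ks.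
Proof.
move=> jk; have jn : (j < n)%N.
  by rewrite ltnNge; apply/negP => nj; rewrite drop_oversize ?size_enum_ord in jk.
move: jk; rewrite (drop_nth k) ?size_enum_ord // => -[<- <-]; split=> //.
by rewrite nth_enum_ord.
Qed.

Lemma drop_enum_ord_nil (n j : nat) : drop j (enum 'I_n) = [::] -> (n <= j)%N.
Proof. by move=> /(congr1 size)/eqP; rewrite size_drop size_enum_ord subn_eq0. Qed.

Lemma big_split_ord_ge (V : nmodType) (n : nat) (k : 'I_n) (F : 'I_n -> V) :
  \sum_(i < n | (k <= i)%N) F i = F k + \sum_(i < n | (k < i)%N) F i.
Proof.
rewrite (bigD1 k) //=; congr (_ + _); apply: eq_bigl => i.
by rewrite ltn_neqAle andbC eq_sym.
Qed.

Lemma big_split_ord_lt (V : nmodType) (n : nat) (k : 'I_n) (F : 'I_n -> V) :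
  \sum_(i < n | (i < k.+1)%N) F i = F k + \sum_(i < n | (i < k)%N) F i.
Proof.
rewrite (bigD1 k) //=; congr (_ + _); apply: eq_bigl => i.
by rewrite ltnS [RHS]ltn_neqAle andbC.
Qed.

Lemma prod_rcons (R : realType) (n : nat) (k : 'I_n) (ts : seq nat) t (F : nat -> 'I_n -> R) :
  size ts = k ->
  \prod_(l < n | (l < size (rcons ts t))%N) F (nth 0%N (rcons ts t) l) l =
  (\prod_(l < n | (l < size ts)%N) F (nth 0%N ts l) l) * F t k.
Proof.
move=> tsk; rewrite (bigD1 k) /= ?size_rcons ?tsk // mulrC nth_rcons tsk ltnn eqxx.
congr (_ * _); apply: eq_big => [l|l /andP[lk lk']].
  by rewrite ltnS [RHS]ltn_neqAle andbC.
by rewrite nth_rcons tsk ltn_neqAle lk' -ltnS lk.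
Qed.

(** * The gap inequality, by induction on the levels *)

Section AcceleratedSliding.
Variables (R : realType) (d n : nat) (Pm : 'M[R]_d).
Hypothesis symP : Pm^T = Pm.
Hypothesis pdP : forall u, u != 0 -> 0 < dot (Pm *m u) u.
Variables (Q : 'I_n -> 'cV[R]_d -> 'cV[R]_d) (L M : 'I_n -> R) (T : 'I_n -> nat).
Hypothesis n_gt0 : (0 < n)%N.
Hypothesis L_gt0 : forall i, 0 < L i.
Hypothesis M_ge0 : forall i, 0 <= M i.
Hypothesis T_gt0 : forall i, (0 < T i)%N.
Hypothesis Q_monotone : forall i z w, 0 <= dot (Q i z - Q i w) (z - w).
(** A Lipschitz bound in the dual norm: [v] represents [Q i z - Q i w] in the inner product of
    [Pm]. *)
Hypothesis Q_lipschitz : forall i z w v, Pm *m v = Q i z - Q i w ->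
  sqn Pm v <= M i ^+ 2 * sqn Pm (z - w).

Local Notation alpha := (alpha R).
Local Notation sqn := (sqn Pm).
Local Notation Hcoef := (@Hcoef R n L M T).
Local Notation rec := (@Rec R d n Q setT L M T Pm).
Local Notation step := (@level_step R d n Q L M T Pm).
Implicit Types (ts : seq nat) (q : 'I_n -> 'cV[R]_d -> R) (z w : 'cV[R]_d).
Implicit Types (s : state R d n) (i k : 'I_n) (h : 'I_n -> R).

(** [aprod] and [bprod] are the factors of [L i] and [M i] in the coefficient [H] of the level
    reached with the indices [ts]. *)
Definition aprod ts : R := \prod_(l < n | (l < size ts)%N) alpha (nth 0%N ts l).

Definition bprod ts : R :=
  \prod_(l < n | (l < size ts)%N) (alpha (nth 0%N ts l) / alpha (T l).-1).

Definition tailprod j i : R := \prod_(l < n | (j <= l <= i)%N) alpha (T l).-1.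

(** The coefficient of the telescoped squared distance of component [i]. Each completed loop of a
    level from [size ts] to [i] contracts the smooth part by [alpha ^+ 2] and the Lipschitz part
    only by [alpha], since [bprod] already carries the inverse of the last [alpha]. *)
Definition weight ts i : R :=
  (L i * aprod ts * tailprod (size ts) i ^+ 2 + M i * bprod ts * tailprod (size ts) i) / 2.

Lemma tailprodS k i : (k <= i)%N -> tailprod k i = alpha (T k).-1 * tailprod k.+1 i.
Proof.
move=> ki; rewrite /tailprod (bigD1 k) /= ?leqnn //; congr (_ * _).
by apply: eq_bigl => l; rewrite [in RHS]ltn_neqAle; case: eqVneq => [->|];
   rewrite ?eqxx ?andbF // => lk; rewrite eq_sym lk andbT.
Qed.

Lemma tailprod_self k : tailprod k.+1 k = 1.
Proof. by apply: big_pred0 => l; rewrite ltnNge; case: leqP. Qed.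

Lemma aprod_rcons ts t k : size ts = k -> aprod (rcons ts t) = aprod ts * alpha t.
Proof. by move=> tsk; rewrite /aprod (prod_rcons _ (fun t _ => alpha t) tsk). Qed.

Lemma bprod_rcons ts t k : size ts = k ->
  bprod (rcons ts t) = bprod ts * (alpha t / alpha (T k).-1).
Proof. by move=> tsk; rewrite /bprod (prod_rcons _ (fun t l => alpha t / alpha (T l).-1) tsk). Qed.

Lemma aprod_gt0 ts : 0 < aprod ts.
Proof. by apply: prodr_gt0 => l _; apply: alpha_gt0. Qed.

Definition valid_indices ts := forall l : 'I_n, (l < size ts)%N -> (nth 0%N ts l < T l)%N.

Lemma valid_indices_rcons ts t k : size ts = k -> (t < T k)%N ->
  valid_indices ts -> valid_indices (rcons ts t).
Proof.
move=> tsk tT Tts l; rewrite size_rcons ltnS nth_rcons leq_eqVlt => /predU1P[lk|lk].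
  by rewrite lk ltnn eqxx (_ : l = k) //; apply: val_inj; rewrite /= lk tsk.
by rewrite lk Tts.
Qed.

Lemma bprod_ge1 ts : valid_indices ts -> 1 <= bprod ts.
Proof.
move=> Tts; rewrite /bprod; elim/big_ind: _ => // [x y x1 y1|l lts].
  by rewrite mulr_ege1.
rewrite ler_pdivlMr ?alpha_gt0 // mul1r alpha_nonincreasing //.
by have := Tts _ lts; have := T_gt0 l; lia.
Qed.

Lemma HcoefE ts t k : size ts = k ->
  Hcoef k (rcons ts t) = L k * aprod (rcons ts t) + M k * bprod (rcons ts t).
Proof.
move=> tsk; rewrite /Hcoef /aprod /bprod.
by congr (_ * _ + _ * _); apply: eq_bigl => l; rewrite size_rcons tsk ltnS.
Qed.

Lemma phat_convex k t q zbar zhalf z i : convex_fun (q i) ->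
  q i (alpha t *: zhalf + (1 - alpha t) *: zbar) - q i z <=
  (1 - alpha t) * (q i zbar - q i z)
  + alpha t * (phat k t q zbar i zhalf - phat k t q zbar i z).
Proof.
move=> cvx; have a0 := alpha_gt0 R t; have a1 := alpha_le1 R t.
have a01 : 0 <= alpha t <= 1 by rewrite ltW.
rewrite /phat; case: (_ <= _)%N; last by have := cvx zhalf zbar _ a01; lra.
rewrite -mulrBr mulrA mulfV ?lt0r_neq0 // mul1r.
by have := cvx z zbar _ a01; lra.
Qed.

(* One extragradient step on the component processed at level k: the strong convexity H of
   the linearized component pays for its smoothness l and for the error of Q k. *)
Lemma extragradient_step k (r : 'cV[R]_d -> R) l H zk zhalf z :
  0 <= l -> 0 < H -> M k ^+ 2 <= H * (H - l) -> convex_smooth Pm l r ->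
  let lin := linearized Pm H zk (grad r zk + Q k zk) in
  let znext := zhalf + invmx (H *: Pm) *m (Q k zk - Q k zhalf) in
  r zhalf - r z + dot (Q k z) (zhalf - z) <=
  lin zhalf - lin z + H / 2 * sqn (zhalf - z) + H / 2 * (sqn (zk - z) - sqn (znext - z)).
Proof.
move=> l0 H0 MH rl; cbv zeta; set v := invmx _ *m _.
have unitHP : H *: Pm \in unitmx.
  by rewrite unitmxZ ?unitfE ?lt0r_neq0 // pd_unitmx.
have HPv : H *: (Pm *m v) = Q k zk - Q k zhalf.
  by rewrite scalemxAl mulKVmx.
have Mv : sqn (H *: v) <= M k ^+ 2 * sqn (zk - zhalf).
  by apply: Q_lipschitz; rewrite -scalemxAr.
have /andP[_ r_up] := convex_smooth_grad pdP rl zk zhalf.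
have /andP[r_lo _] := convex_smooth_grad pdP rl zk z.
have monoQ := Q_monotone k zhalf z.
have dotHPv : dot (Q k zk - Q k zhalf) (zhalf - z) = H * pdot Pm v (zhalf - z).
  by rewrite -HPv dotZl.
have -> : sqn (zhalf + v - z) = sqn (zhalf - z) + 2 * pdot Pm v (zhalf - z) + sqn v.
  rewrite (_ : _ - z = (zhalf - z) + v); last by colring.
  move: (zhalf - z) => u.
  by rewrite /sqn !(pdotDl, pdotDr) (pdotC symP u v); ring.
rewrite /linearized !mxnorm_of_sqr // !(dotC _ (grad r zk + Q k zk)).
rewrite -(sqnN Pm (z - zk)) opprB.
have Hv : H ^+ 2 * sqn v <= M k ^+ 2 * sqn (zk - zhalf).
  by move: Mv; rewrite /sqn pdotZl pdotZr mulrA -expr2.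
have Hv2 : H * sqn v <= (H - l) * sqn (zk - zhalf).
  rewrite -(ler_pM2l H0) mulrA -expr2 (le_trans Hv) // mulrA.
  by rewrite ler_wpM2r ?sqn_ge0.
rewrite -(sqnN Pm (zk - zhalf)) opprB in Hv2.
move: r_up r_lo monoQ dotHPv Hv2; rewrite !dotE; lra.
Qed.

(** Components below [j] are already linearized: their operator sits in the linear term of [q i],
    and the last sum is the strong convexity that minimizing a sum of quadratics yields in
    excess. *)
Definition gap j h q z (v : 'cV[R]_d) : R :=
  \sum_i (q i v - q i z) + \sum_(i < n | (j <= i)%N) dot (Q i z) (v - z)
  + \sum_(i < n | (i < j)%N) h i / 2 * sqn (v - z).

Definition level_family ts h q :=
  (forall i, (i < size ts)%N -> 0 < h i /\ quadratic Pm (h i) (q i)) /\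
  (forall i, (size ts <= i)%N -> convex_smooth Pm (L i * aprod ts) (q i)).

Definition rec_spec ts
    (rc : seq nat -> ('I_n -> 'cV[R]_d -> R) -> state R d n -> 'cV[R]_d * state R d n) :=
  forall h q s, level_family ts h q ->
  (forall z, gap (size ts) h q z (rc ts q s).1 <=
     \sum_(i < n | (size ts <= i)%N)
       weight ts i * (sqn (reg s i - z) - sqn (reg (rc ts q s).2 i - z))) /\
  (forall i, (i < size ts)%N -> reg (rc ts q s).2 i = reg s i).

Definition loop_weight ts k i : R :=
  (L i * aprod ts * tailprod k.+1 i ^+ 2
   + M i * bprod ts / alpha (T k).-1 * tailprod k.+1 i) / 2.

Lemma weight_loop ts k i : size ts = k -> (k <= i)%N ->
  weight ts i = alpha (T k).-1 ^+ 2 * loop_weight ts k i.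
Proof.
move=> tsk ki; rewrite /weight /loop_weight tsk (tailprodS ki).
by have := alpha_gt0 R (T k).-1 => a0; field; rewrite lt0r_neq0.
Qed.

Lemma loop_weight_rcons ts t k i : size ts = k ->
  alpha t ^+ 2 * loop_weight ts k i = alpha t * weight (rcons ts t) i.
Proof.
move=> tsk; rewrite /weight /loop_weight size_rcons tsk (aprod_rcons _ tsk) (bprod_rcons _ tsk).
by have := alpha_gt0 R (T k).-1 => a0; field; rewrite lt0r_neq0.
Qed.

(** The squared distances produced by [extragradient_step] carry the coefficient [H / 2]; hence they
    fit into the same telescoping sum as those of the inner levels. *)
Lemma loop_weight_self ts t k : size ts = k ->
  alpha t ^+ 2 * loop_weight ts k k = alpha t * (Hcoef k (rcons ts t) / 2).
Proof.
move=> tsk; rewrite /loop_weight (HcoefE _ tsk) tailprod_self (aprod_rcons _ tsk).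
rewrite (bprod_rcons _ tsk).
by have := alpha_gt0 R (T k).-1 => a0; field; rewrite lt0r_neq0.
Qed.

Lemma level_family_convex ts h q i : level_family ts h q -> convex_fun (q i).
Proof.
move=> [qlt qge]; have [its|/qge] := ltnP i (size ts); last exact: convex_smooth_convex.
by have [h0] := qlt _ its; apply: quadratic_convex => //; apply: ltW.
Qed.

Lemma bprod_gt0 ts : 0 < bprod ts.
Proof. by apply: prodr_gt0 => l _; rewrite divr_gt0 ?alpha_gt0. Qed.

Lemma Hcoef_gt0 ts t k : size ts = k -> 0 < Hcoef k (rcons ts t).
Proof.
move=> tsk; rewrite (HcoefE _ tsk) ltr_wpDr ?mulr_gt0 ?aprod_gt0 //.
by rewrite mulr_ge0 ?M_ge0 ?ltW ?bprod_gt0.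
Qed.

Lemma gap_convex ts h q z zbar zhalf k t : size ts = k -> level_family ts h q ->
  gap k h q z (alpha t *: zhalf + (1 - alpha t) *: zbar) <=
  (1 - alpha t) * gap k h q z zbar
  + alpha t * gap k h (phat k t q zbar) z zhalf.
Proof.
move=> tsk fam; have a0 := alpha_gt0 R t; have a1 := alpha_le1 R t.
have obj_le : \sum_i (q i (alpha t *: zhalf + (1 - alpha t) *: zbar) - q i z) <=
    (1 - alpha t) * \sum_i (q i zbar - q i z)
    + alpha t * \sum_i (phat k t q zbar i zhalf - phat k t q zbar i z).
  rewrite !mulr_sumr -big_split; apply: ler_sum => i _.
  exact: phat_convex (level_family_convex i fam).
have op_eq : \sum_(i < n | (k <= i)%N) dot (Q i z) (alpha t *: zhalf + (1 - alpha t) *: zbar - z) =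
    (1 - alpha t) * \sum_(i < n | (k <= i)%N) dot (Q i z) (zbar - z)
    + alpha t * \sum_(i < n | (k <= i)%N) dot (Q i z) (zhalf - z).
  by rewrite !mulr_sumr -big_split; apply: eq_bigr => i _ /=; rewrite !dotE; ring.
have reg_le : \sum_(i < n | (i < k)%N)
      h i / 2 * sqn (alpha t *: zhalf + (1 - alpha t) *: zbar - z) <=
    (1 - alpha t) * \sum_(i < n | (i < k)%N) h i / 2 * sqn (zbar - z)
    + alpha t * \sum_(i < n | (i < k)%N) h i / 2 * sqn (zhalf - z).
  rewrite !mulr_sumr -big_split; apply: ler_sum => i ik /=.
  have [h0 _] : 0 < h i /\ quadratic Pm (h i) (q i) by apply: fam.1; rewrite tsk.
  rewrite !(mulrCA _ (h i / 2)) -mulrDr ler_pM2l ?divr_gt0 //.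
  have := @sqn_convex _ _ _ symP pdP (zhalf - z) (zbar - z) (alpha t).
  rewrite ltW //= => /(_ a1); rewrite [in X in _ -> _ <= X]addrC; apply: le_trans.
  by rewrite le_eqVlt; apply/orP; left; apply/eqP; congr sqn; colring.
by rewrite /gap; move=> {tsk}; lra.
Qed.

(** Convexity along the averaging bounds the new gap by the old one and the gap of the rescaled
    problem at [zhalf]. The inner call controls the latter with component [k] linearized, and
    [extragradient_step] repairs this replacement. *)
Lemma level_step_gap rc k ts t q zbar s h :
  size ts = k -> valid_indices ts -> (t < T k)%N -> level_family ts h q ->
  rec_spec (rcons ts t) rc ->
  let r := step rc k ts q (zbar, s) t in
  (forall z, gap k h q z r.1 <= (1 - alpha t) * gap k h q z zbar
     + alpha t ^+ 2 * \sum_(i < n | (k <= i)%N)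
         loop_weight ts k i * (sqn (reg s i - z) - sqn (reg r.2 i - z))) /\
  (forall i, (i < k)%N -> reg r.2 i = reg s i).
Proof.
move=> tsk Tts tT fam spec; rewrite /level_step.
set H := Hcoef k _; set zk := reg s k; set ph := phat k t q zbar.
set lin := linearized _ _ _ _; set q' := (X in rc _ X _); set s1 := (X in rc _ _ X).
have H0 : 0 < H by apply: Hcoef_gt0.
have a0 := alpha_gt0 R t; have a1 := alpha_le1 R t.
have ph_smooth i : (k <= i)%N -> convex_smooth Pm (L i * aprod (rcons ts t)) (ph i).
  move=> ki; rewrite (aprod_rcons _ tsk) mulrA /ph /phat ki.
  by apply: convex_smooth_rescale => //; apply: fam.2; rewrite tsk.
(* The linearized component joins the quadratics with modulus [H]; the resulting term
   [H / 2 * sqn (zhalf - z)] of the inner gap is what [extragradient_step] spends. *)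
pose h' i := if i == k then H else h i.
have fam' : level_family (rcons ts t) h' q'.
  split=> i; rewrite size_rcons tsk => ik; rewrite /q' /h' /=.
    case: eqVneq => [_|]; first by split=> //; apply: quadratic_linearized.
    rewrite -val_eqE => ne_ik; have {}ik : (i < k)%N by rewrite ltn_neqAle ne_ik.
    by rewrite /ph /phat leqNgt ik /=; apply: fam.1; rewrite tsk.
  by rewrite -val_eqE /= gtn_eqF //; apply: ph_smooth; apply: ltnW.
have := spec h' q' s1 fam'; rewrite size_rcons tsk; case: (rc _ q' s1) => zhalf s2 /= [gap' reg'].
split=> [z|i ik]; last by rewrite -val_eqE /= ltn_eqF // reg' // ltnW.
have {}gap' := gap' z.
apply: le_trans (gap_convex z zbar zhalf t tsk fam) _; rewrite lerD2l.
rewrite big_split_ord_ge /= eqxx [leRHS]mulrDr.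
rewrite [X in _ <= X + _]mulrA (loop_weight_self _ tsk) -/H.
rewrite [X in _ + _ * X](eq_bigr (fun i => loop_weight ts k i *
   (sqn (reg s i - z) - sqn (reg s2 i - z)))); last by move=> i ki; rewrite -val_eqE /= gtn_eqF.
rewrite [X in _ + X](_ : _ = alpha t * \sum_(i < n | (k < i)%N) weight (rcons ts t) i *
   (sqn (reg s i - z) - sqn (reg s2 i - z))); last first.
  rewrite !mulr_sumr; apply: eq_bigr => i ki.
  by rewrite [LHS]mulrA (loop_weight_rcons _ _ tsk) [RHS]mulrA.
rewrite -mulrA -mulrDr ler_pM2l //.
have step_k := extragradient_step (k := k) (r := ph k) (l := L k * aprod (rcons ts t))
  (H := H) zk zhalf z.
have {}step_k : ph k zhalf - ph k z + dot (Q k z) (zhalf - z) <=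
   lin zhalf - lin z + H / 2 * sqn (zhalf - z)
   + H / 2 * (sqn (zk - z) - sqn (zhalf + invmx (H *: Pm) *m (Q k zk - Q k zhalf) - z)).
  apply: step_k => //; first by rewrite mulr_ge0 ?ltW ?aprod_gt0.
    (* Here [H - l] is [M k * bprod], and [bprod] is at least 1 because [alpha] is nonincreasing and
       the indices stay below [T]. *)
    rewrite /H (HcoefE _ tsk); have := bprod_ge1 (valid_indices_rcons tsk tT Tts).
    have := aprod_gt0 (rcons ts t); have := L_gt0 k; have := M_ge0 k.
    move: (aprod _) (bprod _) => a b Mk Lk a_gt0 b1.
    have Mb : M k <= M k * b by rewrite ler_peMr.
    rewrite [X in _ <= _ * X](addrAC _ _ (- _)) subrr add0r mulrDl expr2 ler_wpDl ?ler_pM //.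
    by rewrite !mulr_ge0 // ltW // (lt_le_trans ltr01 b1).
  exact: ph_smooth.
move: gap'; rewrite /gap big_split_ord_lt (bigD1 k) //= [X in _ -> X + _ + _ <= _](bigD1 k) //=.
rewrite [X in _ -> _ + X + _ <= _]big_split_ord_ge.
rewrite /q' /= eqxx /h' eqxx -/lin.
rewrite (eq_bigr (fun i => ph i zhalf - ph i z)); last by move=> i /negPf->.
rewrite (eq_bigr (F1 := fun i => _ / 2 * _) (fun i => h i / 2 * sqn (zhalf - z))); last first.
  by move=> i ik; rewrite -val_eqE /= ltn_eqF.
by rewrite -/ph -/zk; move: step_k => {tsk tT}; lra.
Qed.

(* The weights alpha_t^-1 * weight (rcons ts t) do not depend on t, and
   (1 - alpha_(t+1)) / alpha_(t+1)^2 = alpha_t^-2, so the loop telescopes. *)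
Lemma level_loop_gap rc k ts q s h m :
  size ts = k -> valid_indices ts -> (m <= T k)%N -> level_family ts h q ->
  (forall t, (t < T k)%N -> rec_spec (rcons ts t) rc) ->
  let r := foldl (step rc k ts q) (reg s k, s) (iota 0 m) in
  (forall z, (1 - alpha m) / alpha m ^+ 2 * gap k h q z r.1 <=
     \sum_(i < n | (k <= i)%N)
       loop_weight ts k i * (sqn (reg s i - z) - sqn (reg r.2 i - z))) /\
  (forall i, (i < k)%N -> reg r.2 i = reg s i).
Proof.
move=> tsk Tts mT fam spec; elim: m mT => [_|m IH mT].
  (* Since [alpha 0 = 1], the initial gap has coefficient 0, so nothing has to be known about the
     starting average. *)
  split=> // z; rewrite /= subrr mul0r mul0r big1 // => i _.
  by rewrite subrr mulr0.
have -> : iota 0 m.+1 = iota 0 m ++ [:: m] by rewrite -addn1 iotaD.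
rewrite foldl_cat -[foldl _ _ [:: m]]/(step rc k ts q (foldl _ _ _) m).
case: (foldl _ _ _) (IH (ltnW mT)) => zbar s1 [gap1 reg1].
have := level_step_gap zbar s1 tsk Tts mT fam (spec m mT).
case: (step _ _ _ _ _ _) => zbar' s2 /= [gap2 reg2].
split=> [z|i ik]; last by rewrite reg2 ?reg1.
have {}gap1 := gap1 z; have {}gap2 := gap2 z.
have a0 := alpha_gt0 R m; rewrite alphaS_rec -(ler_pM2l (exprn_gt0 2 a0)).
rewrite mulrA mulfV ?lt0r_neq0 ?exprn_gt0 // mul1r; apply: le_trans gap2 _.
have -> : (1 - alpha m) * gap k h q z zbar =
    alpha m ^+ 2 * ((1 - alpha m) / alpha m ^+ 2 * gap k h q z zbar).
  by field; rewrite lt0r_neq0.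
rewrite -mulrDr ler_pM2l ?exprn_gt0 //; apply: le_trans (lerD gap1 (lexx _)) _.
rewrite -big_split /=; apply: ler_sum => i _; rewrite -mulrDr.
by rewrite addrA subrK.
Qed.

(** With no level left, all components are quadratics and the decrease at the minimum of their sum
    cancels the strong convexity terms of [gap] exactly. *)
Lemma Rec_gap ks ts : drop (size ts) (enum 'I_n) = ks -> valid_indices ts ->
  rec_spec ts (rec ks).
Proof.
elim: ks ts => [|k ks IH] ts tsks Tts h q s fam.
  have nts := drop_enum_ord_nil tsks; split=> // z.
  have lt_ts i : (i < size ts)%N by rewrite (leq_trans (ltn_ord i)).
  have sum_lt (F : 'I_n -> R) : \sum_(i < n | (i < size ts)%N) F i = \sum_i F i.
    by apply: eq_bigl => i; rewrite lt_ts.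
  have sum_ge (F : 'I_n -> R) : \sum_(i < n | (size ts <= i)%N) F i = 0.
    by apply: big_pred0 => i; rewrite leqNgt lt_ts.
  rewrite /gap sum_lt !sum_ge addr0 sumrB /=.
  have h_gt0 : 0 < \sum_i h i.
    rewrite (bigD1 (Ordinal n_gt0)) //= ltr_pwDl //;
      first by case: (fam.1 _ (lt_ts (Ordinal n_gt0))).
    by apply: sumr_ge0 => i _; case: (fam.1 _ (lt_ts i)) => /ltW.
  rewrite (quadratic_argmin symP pdP z h_gt0
    (quadratic_sum (fun i => (fam.1 i (lt_ts i)).2))).
  by rewrite -!mulr_suml addNr.
have [tsk tsks'] := drop_enum_ord tsks.
have spec t : (t < T k)%N -> rec_spec (rcons ts t) (rec ks).
  by move=> tT; apply: IH; rewrite ?size_rcons //; apply: valid_indices_rcons tsk tT Tts.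
have [gapT regT] := level_loop_gap s tsk Tts (leqnn _) fam spec.
split=> [z|i]; last by rewrite tsk; apply: regT.
(* After [T k] iterations the coefficient is given by the last weight used, of index [(T k).-1]; the
   positivity of [T k] is needed here. *)
have aT : (1 - alpha (T k)) / alpha (T k) ^+ 2 = (alpha (T k).-1 ^+ 2)^-1.
  by rewrite -[RHS]alphaS_rec prednK.
have a0 := alpha_gt0 R (T k).-1.
have {}gapT := gapT z; rewrite aT ler_pdivrMl ?exprn_gt0 // in gapT.
rewrite tsk; apply: le_trans gapT _; rewrite mulr_sumr; apply: ler_sum => i ki.
by rewrite (weight_loop tsk ki) mulrA.
Qed.

Theorem algorithm1_gap (p : 'I_n -> 'cV[R]_d -> R) zin z :
  (forall i, convex_smooth Pm (L i) (p i)) ->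
  let zout := (algorithm1 p Q setT L M T Pm zin).1 in
  \sum_i (p i zout - p i z) + \sum_i dot (Q i z) (zout - z) <=
  \sum_i (L i * tailprod 0 i ^+ 2 + M i * tailprod 0 i) / 2 * sqn (zin - z).
Proof.
move=> p_smooth; rewrite /algorithm1; set s := State _ _ _.
have aprod0 : aprod [::] = 1 by apply: big_pred0.
have bprod0 : bprod [::] = 1 by apply: big_pred0.
have fam : level_family [::] (fun=> 1) p by split=> // i _; rewrite aprod0 mulr1.
have [] := @Rec_gap (enum 'I_n) [::] (drop0 _) _ _ _ s fam; first by [].
case: (rec _ _ _ _) => zout s' /= /(_ z) gap0 _.
move: gap0; rewrite /gap [X in _ + X <= _]big_pred0 // addr0 => gap0.
apply: le_trans gap0 _; apply: ler_sum => i _ /=.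
have tail_ge0 : 0 <= tailprod 0 i by apply: prodr_ge0 => l _; apply/ltW/alpha_gt0.
have w0 : 0 <= weight [::] i.
  by rewrite /weight aprod0 bprod0 !mulr1 divr_ge0 // addr_ge0 // mulr_ge0 ?exprn_ge0 // ltW.
apply: le_trans (_ : weight [::] i * sqn (zin - z) <= _).
  by rewrite ler_wpM2l // gerBl sqn_ge0.
by rewrite /weight aprod0 bprod0 !mulr1.
Qed.

End AcceleratedSliding.

(** * Counting gradients and operator values *)

Section Counts.
Variables (R : realType) (d n : nat) (Pm : 'M[R]_d).
Variables (Q : 'I_n -> 'cV[R]_d -> 'cV[R]_d) (L M : 'I_n -> R) (T : 'I_n -> nat).
Local Notation rec := (@Rec R d n Q setT L M T Pm).
Local Notation step := (@level_step R d n Q L M T Pm).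

Definition calls j (i : 'I_n) : nat := \prod_(l < n | (j <= l <= i)%N) T l.

(** For a level outside the recursive call, the product [calls] is empty and equals 1, whereas no
    computation is made: hence the case distinction. *)
Definition calls_from j (i : 'I_n) : nat := if (j <= i)%N then calls j i else 0%N.

Definition counts_spec (w : 'I_n -> nat) (s s' : state R d n) :=
  forall i, ngrad s' i = (ngrad s i + w i)%N /\ nQ s' i = (nQ s i + 2 * w i)%N.

Lemma callsS (k i : 'I_n) : (k <= i)%N -> calls k i = (T k * calls k.+1 i)%N.
Proof.
move=> ki; rewrite /calls (bigD1 k) /= ?leqnn //; congr (_ * _)%N.
by apply: eq_bigl => l; rewrite [in RHS]ltn_neqAle; case: eqVneq => [->|];
   rewrite ?eqxx ?andbF // => lk; rewrite eq_sym lk andbT.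
Qed.

Lemma Rec_counts ks ts q s : drop (size ts) (enum 'I_n) = ks ->
  counts_spec (calls_from (size ts)) s (rec ks ts q s).2.
Proof.
elim: ks ts q s => [|k ks IH] ts q s tsks.
  move=> i; rewrite /calls_from leqNgt (leq_trans (ltn_ord i)) ?addn0 //.
  exact: drop_enum_ord_nil tsks.
have [tsk tsks0] := drop_enum_ord tsks.
have tsks' : drop k.+1 (enum 'I_n) = ks by rewrite -tsk.
(* For [i = k] the empty product 1 counts the iteration itself; for inner levels it counts the
   iterations made by the recursive call. *)
pose w (i : 'I_n) := if (k <= i)%N then calls k.+1 i else 0%N.
have step_counts zbar s0 t : counts_spec w s0 (step (rec ks) k ts q (zbar, s0) t).2.
  rewrite /level_step; set q' := (X in rec _ _ X _); set s1 := (X in rec _ _ _ X).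
  have := IH (rcons ts t) q' s1; rewrite size_rcons tsk => /(_ tsks').
  case: (rec _ _ _ _) => zhalf s2 /= spec i; have [] := spec i.
  rewrite /calls_from /w /=; case: eqVneq => [->|].
    rewrite ltnn leqnn /calls big_pred0 => [-> ->|l]; first by lia.
    by rewrite ltnNge; case: leqP.
  by rewrite -val_eqE /= => ik -> ->; rewrite [(k <= i)%N]leq_eqVlt eq_sym (negPf ik).
have loop_counts m : counts_spec (fun i => m * w i)%N s
    (foldl (step (rec ks) k ts q) (reg s k, s) (iota 0 m)).2.
  elim: m => [|m IHm] i; first by rewrite /= mul0n muln0 !addn0.
  have -> : iota 0 m.+1 = iota 0 m ++ [:: m] by rewrite -addn1 iotaD.
  rewrite foldl_cat -[foldl _ _ [:: m]]/(step _ k ts q (foldl _ _ _) m).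
  case: (foldl _ _ _) IHm => zbar s0 /= IHm.
  have [-> ->] := step_counts zbar s0 m i; have [-> ->] := IHm i.
  by split; ring.
move=> i; have [] := loop_counts (T k) i; rewrite /calls_from tsk /w /=.
by case: ifP => [ki|_] -> ->; rewrite ?callsS ?muln0.
Qed.

End Counts.

(** Loops are nested, so inner components are evaluated more often; components with a small budget
    must be placed outermost. *)
Lemma sorting_perm (R : realType) (n : nat) (N : 'I_n -> R) :
  exists c : {perm 'I_n}, forall i j : 'I_n, (i <= j)%N -> N (c i) <= N (c j).
Proof.
pose s := sort (relpre N <=%R) (ord_tuple n).
have s_size : size s == n by rewrite size_sort size_tuple.
have /tuple_permP[c sE] : perm_eq (Tuple s_size) (ord_tuple n) by rewrite /= perm_sort.
exists c => i j ij.
have s_nth l : nth i s l = nth i (Tuple s_size) l by [].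
have nthE l : nth i s (l : 'I_n) = c l.
  rewrite s_nth sE -[nth _ _ _]/(nth i (mktuple (fun i => tnth (ord_tuple n) (c i))) l).
  by rewrite nth_mktuple tnth_ord_tuple.
rewrite -!nthE; apply: (@sorted_leq_nth _ (relpre N <=%R)) => //.
- by move=> x y z; apply: le_trans.
- by move=> x; apply: lexx.
- by apply: sort_sorted => x y; apply: le_total.
- by rewrite inE (eqP s_size).
- by rewrite inE (eqP s_size).
Qed.

Section BlockVectors.
Variables (R : realType) (dx dy : nat).
Implicit Types z w : 'cV[R]_(dx + dy).

Lemma dot_col_mx (x x' : 'cV[R]_dx) (y y' : 'cV[R]_dy) :
  dot (col_mx x y) (col_mx x' y') = dot x x' + dot y y'.
Proof.
by rewrite /dot big_split_ord /=; congr (_ + _); apply: eq_bigr => i _;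
   rewrite ?col_mxEu ?col_mxEd.
Qed.

Lemma dot_vsub z w : dot z w = dot (usubmx z) (usubmx w) + dot (dsubmx z) (dsubmx w).
Proof. by rewrite -dot_col_mx !vsubmxK. Qed.

End BlockVectors.

(** * The instance and its schedules *)

Definition conditions (R : realType) (par : params R) : Prop :=
  [/\ admissible par, Lx par > 4 * mux par /\ Ly par > 4 * muy par,
      Lxy par > 18 * Num.max (muxy par) (Num.max (muyx par) (Num.sqrt (mux par * muy par))),
      Num.sqrt (Lx par * Ly par) > 4 * Num.max (muxy par) (muyx par)
    & Num.min (delta_x par) (delta_y par) > 0].

(** * Consequences of the conditions on the parameters *)

Section ParameterBounds.
Variables (R : realType) (par : params R).
Hypothesis par_ok : conditions par.

Lemma Lx_gt0 : 0 < Lx par. Proof. by case: par_ok => -[[? ?] _ _ _ _] _ _ _ _; lra. Qed.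
Lemma Ly_gt0 : 0 < Ly par. Proof. by case: par_ok => -[_ [? ?] _ _ _] _ _ _ _; lra. Qed.
Lemma Lxy_gt0 : 0 < Lxy par. Proof. by case: par_ok => -[_ _ [? ?] _ _] _ _ _ _; lra. Qed.
Lemma mux_ge0 : 0 <= mux par. Proof. by case: par_ok => -[[? ?] _ _ _ _]. Qed.
Lemma muy_ge0 : 0 <= muy par. Proof. by case: par_ok => -[_ [? ?] _ _ _]. Qed.
Lemma muxy_ge0 : 0 <= muxy par. Proof. by case: par_ok => -[_ _ [? ?] _ _]. Qed.
Lemma muyx_ge0 : 0 <= muyx par. Proof. by case: par_ok => -[_ _ _ [? ?] _]. Qed.

Lemma delta_x_gt0 : 0 < delta_x par.
Proof. by case: par_ok => _ _ _ _; rewrite lt_min => /andP[]. Qed.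

Lemma delta_y_gt0 : 0 < delta_y par.
Proof. by case: par_ok => _ _ _ _; rewrite lt_min => /andP[]. Qed.

Lemma coupling_le (m : R) : 0 <= m -> m <= Num.max (muxy par) (muyx par) ->
  16 * m ^+ 2 <= Lx par * Ly par.
Proof.
move=> m0 m_max; case: par_ok => _ _ _ LL _; have LL0 := mulr_gt0 Lx_gt0 Ly_gt0.
rewrite -(sqr_sqrtr (ltW LL0)); have : 4 * m <= Num.sqrt (Lx par * Ly par) by lra.
nra.
Qed.

Lemma muxy_sqr_le : muxy par ^+ 2 / Ly par <= Lx par / 16.
Proof.
have := coupling_le muxy_ge0; rewrite le_max lexx => /(_ isT).
by rewrite ler_pdivrMr ?Ly_gt0 //; lra.
Qed.

Lemma muyx_sqr_le : muyx par ^+ 2 / Lx par <= Ly par / 16.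
Proof.
have := coupling_le muyx_ge0; rewrite le_max lexx orbT => /(_ isT).
by rewrite ler_pdivrMr ?Lx_gt0 //; lra.
Qed.

(** The two summands of [delta_x] are below 1/4 and 1/16 of [Lx], and 5/16 is less than 1/3. *)
Lemma delta_x_le : 3 * delta_x par <= Lx par.
Proof.
case: par_ok => _ [H _] _ _ _; have := muxy_sqr_le; have := Lx_gt0.
rewrite /delta_x; lra.
Qed.

Lemma delta_y_le : 3 * delta_y par <= Ly par.
Proof.
case: par_ok => _ [_ H] _ _ _; have := muyx_sqr_le; have := Ly_gt0.
rewrite /delta_y; lra.
Qed.

(** The product expands into four terms, at most 1, 1/4, 1/4 and 1/16 times quantities that are each
    at most [Lxy ^+ 2 / 18]. *)
Lemma delta_xy_le : delta_x par * delta_y par <= Lxy par ^+ 2.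
Proof.
case: par_ok => _ [Hx Hy] HL _ _.
have mxL : mux par <= Lx par / 4 by lra.
have myL : muy par <= Ly par / 4 by lra.
have Lxy0 := Lxy_gt0; have mx0 := mux_ge0; have my0 := muy_ge0.
have sqr_le m : 0 <= m ->
    m <= Num.max (muxy par) (Num.max (muyx par) (Num.sqrt (mux par * muy par))) ->
  18 * m ^+ 2 <= Lxy par ^+ 2.
  by move=> m0 mM; have : 18 * m <= Lxy par; [lra | nra].
have s1 : 18 * muxy par ^+ 2 <= Lxy par ^+ 2.
  by apply: sqr_le; rewrite ?muxy_ge0 // le_max lexx.
have s2 : 18 * muyx par ^+ 2 <= Lxy par ^+ 2.
  by apply: sqr_le; rewrite ?muyx_ge0 // !le_max lexx orbT.
have s3 : 18 * Num.sqrt (mux par * muy par) ^+ 2 <= Lxy par ^+ 2.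
  by apply: sqr_le; rewrite ?sqrtr_ge0 // !le_max lexx !orbT.
rewrite sqr_sqrtr ?mulr_ge0 // in s3.
have aL := muxy_sqr_le; have bL := muyx_sqr_le; rewrite /delta_x /delta_y.
have a_def : muxy par ^+ 2 / Ly par * Ly par = muxy par ^+ 2.
  by rewrite divfK // lt0r_neq0 ?Ly_gt0.
have b_def : muyx par ^+ 2 / Lx par * Lx par = muyx par ^+ 2.
  by rewrite divfK // lt0r_neq0 ?Lx_gt0.
have a0 : 0 <= muxy par ^+ 2 / Ly par by rewrite divr_ge0 ?sqr_ge0 ?ltW ?Ly_gt0.
have b0 : 0 <= muyx par ^+ 2 / Lx par by rewrite divr_ge0 ?sqr_ge0 ?ltW ?Lx_gt0.
move: a_def b_def s1 s2 s3 aL bL a0 b0.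
move: (muxy par ^+ 2 / Ly par) (muyx par ^+ 2 / Lx par) => a b.
move: (muxy par ^+ 2) (muyx par ^+ 2) => m1 m2 am bm s1 s2 s3 aL bL a0 b0.
have t1 : mux par * b <= Lx par / 4 * b by rewrite ler_wpM2r.
have t2 : a * muy par <= a * (Ly par / 4) by rewrite ler_wpM2l.
have t3 : a * b <= Lx par / 16 * b by rewrite ler_wpM2r.
by rewrite mulrDl !mulrDr; have := sqr_ge0 (Lxy par); lra.
Qed.

Lemma kappa_x_ge1 : 1 <= kappa_x par.
Proof.
have := delta_x_le; have := delta_x_gt0 => d0.
by rewrite ler_pdivlMr // mul1r; lra.
Qed.

Lemma kappa_y_ge1 : 1 <= kappa_y par.
Proof.
have := delta_y_le; have := delta_y_gt0 => d0.
by rewrite ler_pdivlMr // mul1r; lra.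
Qed.

Lemma kappa_xy_ge1 : 1 <= kappa_xy par.
Proof. by rewrite ler_pdivlMr ?mul1r ?delta_xy_le ?mulr_gt0 ?delta_x_gt0 ?delta_y_gt0. Qed.

End ParameterBounds.

Lemma lambda_max_opnorm (R : realType) (m n : nat) (B : 'M[R]_(m, n)) (K : R) :
  (lambda_max (B^T *m B) <= K%:E)%E -> forall x, dot (B *m x) (B *m x) <= K * dot x x.
Proof.
move=> BK x; rewrite dot_trmx mulmxA dotC; apply: rayleigh_le.
  by rewrite trmx_mul trmxK.
move=> a eig_a; rewrite -lee_fin; apply: le_trans BK.
by apply: ereal_sup_ubound; exists a.
Qed.

(** With [v = B^T *m y], Cauchy-Schwarz for [dot v v = dot (B *m v) y] leaves a factor [dot v v] to
    cancel. *)
Lemma opnorm_trmx (R : realType) (m n : nat) (B : 'M[R]_(m, n)) (K : R) : 0 <= K ->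
  (forall x, dot (B *m x) (B *m x) <= K * dot x x) ->
  forall y, dot (B^T *m y) (B^T *m y) <= K * dot y y.
Proof.
move=> K0 BK y; set v := B^T *m y.
have [v0|v0] := eqVneq (dot v v) 0; first by rewrite v0 mulr_ge0 ?dot_ge0.
have {}v0 : 0 < dot v v by rewrite lt0r v0 dot_ge0.
have vv : dot v v = dot (B *m v) y by rewrite dot_trmx.
rewrite -(ler_pM2r v0) -expr2 [in leLHS]vv mulrAC.
by apply: le_trans (cauchy_schwarz _ _) _; rewrite ler_wpM2r ?dot_ge0 ?BK.
Qed.

Lemma convex_smooth_bregman (R : realType) (d : nat) (h : 'cV[R]_d -> R) (l : R) :
  strongly_convex 0 h -> smooth l h -> forall z w,
  0 <= h w - h z - dot (grad h z) (w - z) <= l / 2 * dot (w - z) (w - z).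
Proof.
move=> cvx_h smooth_h z w; have := cvx_h w z; have := smooth_h w z.
rewrite /bregman enorm_sqr mul0r mul0r => up ->.
exact: le_trans (ler_norm _) up.
Qed.

Section InstanceProperties.
Variables (R : realType) (dx dy : nat).
Variables (f : 'cV[R]_dx -> R) (g : 'cV[R]_dy -> R) (B : 'M[R]_(dy, dx)).
Variable par : params R.
Hypothesis par_ok : conditions par.
Hypothesis reg_ok : regular f g B par.

Local Notation Pm := (inst_P dx dy par).
Implicit Types z w : 'cV[R]_(dx + dy).

Lemma mulmx_inst_P z :
  Pm *m z = col_mx (delta_x par *: usubmx z) (delta_y par *: dsubmx z).
Proof.
by rewrite -{1}(vsubmxK z) mul_block_col !mul0mx addr0 add0r !mul_scalar_mx.
Qed.

Lemma sqn_inst_P z : sqn Pm z =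
  delta_x par * dot (usubmx z) (usubmx z) + delta_y par * dot (dsubmx z) (dsubmx z).
Proof. by rewrite /sqn /pdot mulmx_inst_P dot_vsub col_mxKu col_mxKd !dotZl. Qed.

Lemma inst_P_sym : Pm^T = Pm.
Proof. by rewrite tr_block_mx !tr_scalar_mx !trmx0. Qed.

Lemma inst_P_pd z : z != 0 -> 0 < dot (Pm *m z) z.
Proof.
rewrite -[dot _ _]/(sqn Pm z) sqn_inst_P -dot_gt0 dot_vsub => z0.
have dx0 := delta_x_gt0 par_ok; have dy0 := delta_y_gt0 par_ok.
have := dot_ge0 (usubmx z); have := dot_ge0 (dsubmx z).
rewrite le_eqVlt => /predU1P[y0|y0]; rewrite le_eqVlt => /predU1P[x0|x0]; nra.
Qed.

Lemma f_bregman x x' : 0 <= f x' - f x - dot (grad f x) (x' - x)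
  <= Lx par / 2 * dot (x' - x) (x' - x).
Proof. by case: reg_ok => _ [? _ ?] _ _ _; apply: convex_smooth_bregman. Qed.

Lemma g_bregman y y' : 0 <= g y' - g y - dot (grad g y) (y' - y)
  <= Ly par / 2 * dot (y' - y) (y' - y).
Proof. by case: reg_ok => _ _ [? _ ?] _ _; apply: convex_smooth_bregman. Qed.

Lemma mulmx_B_le x : dot (B *m x) (B *m x) <= Lxy par ^+ 2 * dot x x.
Proof. by case: reg_ok => _ _ _ _; move/lambda_max_opnorm. Qed.

Lemma mulmx_Btr_le y : dot (B^T *m y) (B^T *m y) <= Lxy par ^+ 2 * dot y y.
Proof. exact: opnorm_trmx (sqr_ge0 _) mulmx_B_le y. Qed.

Lemma kappa_xE : kappa_x par * delta_x par = Lx par.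
Proof. by rewrite divfK // lt0r_neq0 ?delta_x_gt0. Qed.

Lemma kappa_yE : kappa_y par * delta_y par = Ly par.
Proof. by rewrite divfK // lt0r_neq0 ?delta_y_gt0. Qed.

Lemma kappa_xyE : kappa_xy par * (delta_x par * delta_y par) = Lxy par ^+ 2.
Proof. by rewrite divfK // lt0r_neq0 ?mulr_gt0 ?delta_x_gt0 ?delta_y_gt0. Qed.

Lemma inst_L_gt0 i : 0 < inst_L par i.
Proof.
rewrite /inst_L /triple; case: i => [[|[|[|//]]] ?] /=; apply: lt_le_trans ltr01 _.
- exact: kappa_x_ge1.
- exact: kappa_y_ge1.
- exact: kappa_xy_ge1.
Qed.

Lemma inst_M_ge0 i : 0 <= inst_M par i.
Proof. by rewrite /inst_M /triple; case: i => [[|[|[|//]]] ?] /=; rewrite ?sqrtr_ge0. Qed.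

Lemma inst_Q_monotone i z w : 0 <= dot (inst_Q B i z - inst_Q B i w) (z - w).
Proof.
rewrite /inst_Q /triple; case: i => [[|[|[|//]]] ?] /=; rewrite ?subrr ?dot0l //.
rewrite opp_col_mx add_col_mx dot_vsub col_mxKu col_mxKd !linearB /=.
by rewrite !dotE !(dot_trmx B^T) trmxK !(dotC (B *m _)); lra.
Qed.

(** The dual norm divides the blocks by [delta_x] and [delta_y]; as [Q_3] exchanges the blocks, the
    ratio [Lxy ^+ 2 / (delta_x * delta_y)] arises in both. *)
Lemma inst_Q_lipschitz i z w v : Pm *m v = inst_Q B i z - inst_Q B i w ->
  sqn Pm v <= inst_M par i ^+ 2 * sqn Pm (z - w).
Proof.
rewrite /inst_Q /inst_M /triple.
have dx0 := delta_x_gt0 par_ok; have dy0 := delta_y_gt0 par_ok.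
case: i => [[|[|[|//]]] ?] /=.
- by rewrite subrr /sqn /pdot => ->; rewrite dot0l expr0n mul0r.
- by rewrite subrr /sqn /pdot => ->; rewrite dot0l expr0n mul0r.
have k0 : 0 <= kappa_xy par by have := kappa_xy_ge1 par_ok; lra.
rewrite mulmx_inst_P opp_col_mx add_col_mx sqr_sqrtr // => /eq_col_mx[vx vy].
rewrite !sqn_inst_P.
have := mulmx_Btr_le (dsubmx (z - w)); have := mulmx_B_le (usubmx (z - w)).
have -> : B^T *m dsubmx (z - w) = delta_x par *: usubmx v.
  by rewrite vx linearB mulmxBr.
have -> : B *m usubmx (z - w) = - (delta_y par *: dsubmx v).
  by rewrite vy linearB mulmxBr opprB opprK addrC.
rewrite !dotE -kappa_xyE.
move=> Hy Hx; rewrite mulrDr addrC; apply: lerD.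
  by rewrite -(ler_pM2l dy0); lra.
by rewrite -(ler_pM2l dx0); lra.
Qed.

(** For [p_3], the curvature in x is at most [Lxy ^+ 2 / (4 * Ly)], that is [kappa_xy * delta_x]
    times [delta_y / (4 * Ly)], and the last factor is at most 1/12; likewise in y. *)
Lemma inst_p_smooth zin i : convex_smooth Pm (inst_L par i) (inst_p f g B par zin i).
Proof.
have dx0 := delta_x_gt0 par_ok; have dy0 := delta_y_gt0 par_ok.
have Lx0 := Lx_gt0 par_ok; have Ly0 := Ly_gt0 par_ok.
have k0 : 0 <= kappa_xy par by have := kappa_xy_ge1 par_ok; lra.
rewrite /inst_L /inst_p /triple; case: i => [[|[|[|//]]] ?] /=.
- exists (fun z => col_mx (grad f (usubmx z)) 0) => z w.
  rewrite dot_vsub col_mxKu col_mxKd dot0l addr0 sqn_inst_P linearB.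
  have /andP[-> /le_trans->//] := f_bregman (usubmx z) (usubmx w).
  rewrite -kappa_xE; have y0 := dot_ge0 (dsubmx (w - z)).
  have k1 : 0 <= kappa_x par by have := kappa_x_ge1 par_ok; lra.
  have : 0 <= kappa_x par * (delta_y par * dot (dsubmx (w - z)) (dsubmx (w - z))).
    by apply: mulr_ge0 => //; apply: mulr_ge0 => //; apply: ltW.
  by rewrite linearB /=; lra.
- exists (fun z => col_mx 0 (grad g (dsubmx z))) => z w.
  rewrite dot_vsub col_mxKu col_mxKd dot0l add0r sqn_inst_P !linearB /=.
  have /andP[-> /le_trans->//] := g_bregman (dsubmx z) (dsubmx w).
  rewrite -kappa_yE; have k1 : 0 <= kappa_y par by have := kappa_y_ge1 par_ok; lra.
  have x0 := dot_ge0 (usubmx w - usubmx z).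
  have : 0 <= kappa_y par * (delta_x par * dot (usubmx w - usubmx z) (usubmx w - usubmx z)).
    by apply: mulr_ge0 => //; apply: mulr_ge0 => //; apply: ltW.
  by lra.
exists (fun z => col_mx
  ((8 * Ly par)^-1 *: (2 *: (B^T *m (B *m usubmx z - grad g (dsubmx zin)))))
  ((8 * Lx par)^-1 *: (2 *: (B *m (B^T *m dsubmx z + grad f (usubmx zin)))))) => z w.
have uB : usubmx (w - z) = usubmx w - usubmx z by rewrite linearB.
have dB : dsubmx (w - z) = dsubmx w - dsubmx z by rewrite linearB.
rewrite dot_vsub col_mxKu col_mxKd sqn_inst_P !enorm_sqr uB dB.
rewrite [X in _ <= X <= _](_ : _ =
  (8 * Ly par)^-1 * dot (B *m (usubmx w - usubmx z)) (B *m (usubmx w - usubmx z))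
  + (8 * Lx par)^-1 * dot (B^T *m (dsubmx w - dsubmx z)) (B^T *m (dsubmx w - dsubmx z))); last first.
  have scaled_adj m k (A : 'M[R]_(m, k)) (a b : R) u v :
      dot (a *: (b *: (A *m u))) v = a * (b * dot u (A^T *m v)).
    by rewrite !dotZl dot_trmx.
  rewrite !scaled_adj trmxK !mulmxBr !dotE.
  move: (B *m usubmx w) (B *m usubmx z) (B^T *m dsubmx w) (B^T *m dsubmx z) => a a' b b'.
  move: (grad g _) (grad f _) => gg gf.
  by rewrite (dotC a a') (dotC gg a) (dotC gg a') (dotC b b') (dotC gf b) (dotC gf b'); ring.
have x_le := mulmx_B_le (usubmx w - usubmx z); have x0 := dot_ge0 (usubmx w - usubmx z).
have y_le := mulmx_Btr_le (dsubmx w - dsubmx z); have y0 := dot_ge0 (dsubmx w - dsubmx z).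
apply/andP; split.
  by rewrite addr_ge0 // mulr_ge0 ?dot_ge0 // invr_ge0; lra.
rewrite mulrDr; apply: lerD.
  rewrite mulrC ler_pdivrMr; last lra; apply: le_trans x_le _.
  rewrite -kappa_xyE (mulrA _ _ (dot _ _)) -mulrA; have := delta_y_le par_ok => dyL.
  have : delta_y par * (kappa_xy par * delta_x par * dot (usubmx w - usubmx z) (usubmx w - usubmx z))
    <= Ly par * (kappa_xy par * delta_x par * dot (usubmx w - usubmx z) (usubmx w - usubmx z)).
    by rewrite ler_wpM2r //; [do !apply: mulr_ge0 => // | ]; lra.
  have : 0 <= Ly par * (kappa_xy par * delta_x par * dot (usubmx w - usubmx z) (usubmx w - usubmx z)).
    by do !apply: mulr_ge0 => //; lra.
  lra.
rewrite mulrC ler_pdivrMr; last lra; apply: le_trans y_le _.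
rewrite -kappa_xyE; have := delta_x_le par_ok => dxL.
have : delta_x par * (kappa_xy par * delta_y par * dot (dsubmx w - dsubmx z) (dsubmx w - dsubmx z))
  <= Lx par * (kappa_xy par * delta_y par * dot (dsubmx w - dsubmx z) (dsubmx w - dsubmx z)).
  by rewrite ler_wpM2r //; [do !apply: mulr_ge0 => // | ]; lra.
have : 0 <= Lx par * (kappa_xy par * delta_y par * dot (dsubmx w - dsubmx z) (dsubmx w - dsubmx z)).
  by do !apply: mulr_ge0 => //; lra.
lra.
Qed.

(** Round [2 * r] down to [t]: then [2 * r < t + 1], while [alpha t.-1 <= 2 / (t + 1)]. *)
Lemma iterations_exist (r : R) : 1 <= r ->
  exists t : nat, [/\ (0 < t)%N, t%:R <= 2 * r & alpha R t.-1 <= r^-1].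
Proof.
move=> r1; have r0 : 0 < r by lra.
exists (Num.truncn (2 * r)); have t0 : (0 < Num.truncn (2 * r))%N by rewrite truncn_gt0; lra.
split=> //; first by rewrite truncn_le mulr_ge0 // ltW.
apply: le_trans (alpha_le _ _) _; rewrite prednK // ler_pdivrMr // mulrC ler_pdivlMr //.
exact/ltW/truncnS_gt.
Qed.

Let budget i := Num.max (Num.sqrt (inst_L par i / tol R)) (Num.max (inst_M par i / tol R) 1).

Lemma budget_ge1 i : 1 <= budget i.
Proof. by rewrite /budget !le_max lexx !orbT. Qed.

(** Each of the two summands is at most [tol], hence so is half their sum; the three components
    together give the required [3 * tol]. *)
Lemma budget_weight i (a : R) : 0 <= a -> a <= (budget i)^-1 ->
  (inst_L par i * a ^+ 2 + inst_M par i * a) / 2 <= tol R.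
Proof.
move=> a0 ab; have b1 := budget_ge1 i; have b0 : 0 < budget i by lra.
have {}ab : budget i * a <= 1 by rewrite -ler_pdivlMl // mulr1.
have tol0 : 0 < tol R by rewrite invr_gt0.
have sqrt_b : Num.sqrt (inst_L par i / tol R) <= budget i by rewrite /budget le_max lexx.
have M_b : inst_M par i / tol R <= budget i by rewrite /budget !le_max lexx orbT.
have L_a : inst_L par i * a ^+ 2 <= tol R.
  have Lt : inst_L par i / tol R <= budget i ^+ 2.
    rewrite -[leLHS]sqr_sqrtr; first by rewrite ler_pXn2r ?nnegrE ?sqrtr_ge0 // ltW.
    by rewrite divr_ge0 ?ltW ?inst_L_gt0.
  rewrite ler_pdivrMr // in Lt.
  have : inst_L par i * a ^+ 2 <= budget i ^+ 2 * tol R * a ^+ 2 by rewrite ler_wpM2r ?sqr_ge0.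
  have : (budget i * a) ^+ 2 <= 1 by rewrite expr_le1 // mulr_ge0 // ltW.
  move=> s1 s2; apply: le_trans s2 _.
  by rewrite mulrAC -exprMn -[leRHS]mul1r ler_pM2r.
have M_a : inst_M par i * a <= tol R.
  rewrite ler_pdivrMr // in M_b; apply: le_trans (ler_wpM2r a0 M_b) _.
  by rewrite mulrAC -[leRHS]mul1r ler_pM2r.
lra.
Qed.

(* With the pairs in increasing order of their budgets b_1 <= b_2 <= b_3 (and b_0 = 1), take T_k
   about 2 b_k / b_(k-1). *)
Lemma iterations_for_budget : exists c : schedule,
  (forall k, (0 < c.2 k)%N) /\
  (forall k, tailprod R c.2 0 k <= (budget (c.1 k))^-1 /\
             (calls c.2 0 k)%:R <= 8 * budget (c.1 k)).
Proof.
have [c c_sorted] := sorting_perm budget.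
pose b0 := budget (c idx_f); pose b1 := budget (c idx_g); pose b2 := budget (c idx_B).
have b0_ge1 : 1 <= b0 := budget_ge1 _.
have b01 : b0 <= b1 by apply: c_sorted.
have b12 : b1 <= b2 by apply: c_sorted.
have ratio_ge1 (a b : R) : 1 <= a -> a <= b -> 1 <= b / a.
  by move=> a1 ab; rewrite ler_pdivlMr ?mul1r //; lra.
have b1_ge1 : 1 <= b1 by lra.
have [t0 [t0_gt0 t0_le a0_le]] := iterations_exist b0_ge1.
have [t1 [t1_gt0 t1_le a1_le]] := iterations_exist (ratio_ge1 _ _ b0_ge1 b01).
have [t2 [t2_gt0 t2_le a2_le]] := iterations_exist (ratio_ge1 _ _ b1_ge1 b12).
have a0 := alpha_gt0 R t0.-1; have a1 := alpha_gt0 R t1.-1; have a2 := alpha_gt0 R t2.-1.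
exists (c, triple t0 t1 t2); split=> [k|k] /=.
  by rewrite /triple; case: k => [[|[|[|//]]] ?].
rewrite /tailprod big_mkcond !big_ord_recl big_ord0.
rewrite /calls big_mkcond !big_ord_recl big_ord0 /triple /=.
have T1_le : t0%:R * t1%:R <= 4 * b1.
  have : t0%:R * t1%:R <= 2 * b0 * (2 * (b1 / b0)) by rewrite ler_pM.
  by rewrite (_ : _ * _ * (2 * _) = 4 * b1) //; field; lra.
have T2_le : t0%:R * t1%:R * t2%:R <= 8 * b2.
  have : t0%:R * t1%:R * t2%:R <= 4 * b1 * (2 * (b2 / b1)) by rewrite ler_pM ?mulr_ge0.
  by rewrite (_ : _ * _ * (2 * _) = 8 * b2) //; field; lra.
have A1_le : alpha R t0.-1 * alpha R t1.-1 <= b1^-1.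
  have : alpha R t0.-1 * alpha R t1.-1 <= b0^-1 * (b1 / b0)^-1 by rewrite ler_pM // ltW.
  by rewrite (_ : _ * (_ / _)^-1 = b1^-1) //; field; lra.
have A2_le : alpha R t0.-1 * alpha R t1.-1 * alpha R t2.-1 <= b2^-1.
  have : alpha R t0.-1 * alpha R t1.-1 * alpha R t2.-1 <= b1^-1 * (b2 / b1)^-1.
    by rewrite ler_pM ?mulr_ge0 // ltW.
  by rewrite (_ : _ * (_ / _)^-1 = b2^-1) //; field; lra.
have t0R : 0 <= t0%:R :> R by [].
case: k => [[|[|[|//]]] k_lt] /=; rewrite !mulr1 !muln1 ?natrM ?mulrA.
- rewrite (_ : Ordinal k_lt = idx_f) -/b0; last exact: val_inj.
  by split=> //; lra.
- rewrite (_ : Ordinal k_lt = idx_g) -/b1; last exact: val_inj.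
  by split=> //; lra.
- rewrite (_ : Ordinal k_lt = idx_B) -/b2; last exact: val_inj.
  by split=> //; lra.
Qed.

(** The budgets depend only on [par], so one schedule serves all inputs. It uses at most 8 budgets
    of gradients and 16 of values of [Q], within the allowed factor [6 ^+ 3]. *)
Lemma valid_schedule_exists : exists c : schedule, forall zin, valid_schedule f g B par zin c.
Proof.
have [c [T_gt0 c_ok]] := iterations_for_budget; exists c => zin.
have tail_ge0 k : 0 <= tailprod R c.2 0 k by apply: prodr_ge0 => l _; apply/ltW/alpha_gt0.
split=> // [z|i].
  have Lc0 k : 0 < (inst_L par \o c.1) k by apply: inst_L_gt0.
  have Mc0 k : 0 <= (inst_M par \o c.1) k by apply: inst_M_ge0.
  have := algorithm1_gap inst_P_sym inst_P_pd (Q := inst_Q B \o c.1) isT Lc0 Mc0 T_gt0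
    (fun k => inst_Q_monotone (c.1 k)) (fun k => @inst_Q_lipschitz (c.1 k)) zin z
    (fun k => inst_p_smooth zin (c.1 k)).
  rewrite -[algorithm1 _ _ _ _ _ _ _ _]/(run f g B par zin c) /=.
  set zout := (run _ _ _ _ _ _).1; rewrite sumrB => gap.
  have perm_sum (F : 'I_3 -> R) : \sum_i F (c.1 i) = \sum_i F i.
    by rewrite [RHS](reindex_inj (@perm_inj _ c.1)).
  rewrite (perm_sum (fun i => inst_p f g B par zin i zout)) in gap.
  rewrite (perm_sum (fun i => inst_p f g B par zin i z)) in gap.
  rewrite (perm_sum (fun i => dot (inst_Q B i z) (zout - z))) in gap.
  rewrite dot_suml mxnorm_of_sqr; last exact: inst_P_pd.
  apply: le_trans gap _; rewrite -mulr_suml ler_wpM2r ?sqn_ge0 //; first exact: inst_P_pd.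
  have -> : 3 * tol R = \sum_(k < 3) tol R by rewrite sumr_const card_ord mulr_natl.
  by apply: ler_sum => k _; apply: budget_weight => //; case: (c_ok k).
have [k ->] : exists k, i = c.1 k by exists ((c.1^-1)%g i); rewrite permKV.
have [_ calls_le] := c_ok k.
have := Rec_counts Pm (inst_Q B \o c.1) (inst_L par \o c.1) (inst_M par \o c.1) c.2
  (ts := [::]) (inst_p f g B par zin \o c.1)
  (State (fun=> zin) (fun=> 0%N) (fun=> 0%N)) (drop0 _) k.
rewrite /run_ngrad /run_nQ permK -[Rec _ _ _ _ _ _ _ _ _ _]/(run f g B par zin c).
rewrite /calls_from /= => -[-> ->]; rewrite !add0n natrM -/(budget (c.1 k)).
by have b1 := budget_ge1 (c.1 k); split; lra.
Qed.

End InstanceProperties.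

(** * Existence of a saddle point *)

Lemma geometric_bound_eq0 (R : realType) (x K q : R) : 0 <= x -> 0 <= q < 1 ->
  (forall k, x <= K * q ^+ k) -> x = 0.
Proof.
move=> x0 /andP[q0 q1] xK; apply/eqP; rewrite eq_le x0 andbT.
have q_lt1 : `|q| < 1 by rewrite ger0_norm.
have Kq : K * q ^+ k @[k --> \oo] --> (0 : R).
  by rewrite -(mulr0 K); apply: cvgMl_tmp; apply: cvg_expr.
by rewrite -(cvg_lim (@Rhausdorff R) Kq); apply: limr_ge;
  [apply/cvg_ex; exists 0 | apply: nearW].
Qed.

(* The intervals [u k - C r^k, u k + C r^k] with C = c / (1 - r) are nested. *)
Lemma geometric_cauchy (R : realType) (u : nat -> R) (c r : R) : 0 <= c -> 0 <= r < 1 ->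
  (forall k, `|u k.+1 - u k| <= c * r ^+ k) ->
  exists p, forall k, `|u k - p| <= c / (1 - r) * r ^+ k.
Proof.
move=> c0 /andP[r0 r1] uS; set C := c / (1 - r).
have CE : c = C * (1 - r) by rewrite divfK //; lra.
pose lo k := u k - C * r ^+ k; pose up k := u k + C * r ^+ k.
have C_ge0 k : 0 <= C * r ^+ k.
  by rewrite mulr_ge0 ?exprn_ge0 // divr_ge0 //; lra.
have loS k m : lo k <= lo (k + m)%N.
  elim: m => [|m IH]; rewrite ?addn0 // addnS (le_trans IH) // /lo exprS.
  by have := uS (k + m)%N; rewrite ler_norml {1}CE => /andP[? _]; lra.
have upS k m : up (k + m)%N <= up k.
  elim: m => [|m IH]; rewrite ?addn0 // addnS (le_trans _ IH) // /up exprS.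
  by have := uS (k + m)%N; rewrite ler_norml {2}CE => /andP[_ ?]; lra.
have lo_up k m : lo k <= up m.
  apply: le_trans (loS k m) _; rewrite addnC; apply: le_trans (upS m k).
  by rewrite /lo /up; have := C_ge0 (m + k)%N; lra.
have sup_lo : has_sup (range lo).
  by split; [exists (lo 0%N); exists 0%N | exists (up 0%N) => _ [k _ <-]].
exists (sup (range lo)) => k.
have : lo k <= sup (range lo) by apply: ub_le_sup; [case: sup_lo | exists k].
have : sup (range lo) <= up k by apply: ge_sup => [|_ [m _ <-]]; first by case: sup_lo.
by rewrite /lo /up ler_norml; lra.
Qed.

(** The iterates from 0 make geometrically small Euclidean steps, hence geometrically small steps in
    each coordinate; the limit is taken coordinatewise, with a rate. *)
Lemma contraction_fixed_point (R : realType) (d : nat) (S : 'cV[R]_d -> 'cV[R]_d) (r : R) :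
  0 <= r < 1 ->
  (forall z w, dot (S z - S w) (S z - S w) <= r ^+ 2 * dot (z - w) (z - w)) ->
  exists z, S z = z.
Proof.
move=> r01 S_contr; have /andP[r0 r1] := r01.
pose z k := iter k S 0; pose c := enorm (z 1%N - z 0%N).
have c0 : 0 <= c := enorm_ge0 _.
have zS k : dot (z k.+1 - z k) (z k.+1 - z k) <= (c * r ^+ k) ^+ 2.
  elim: k => [|k IH]; first by rewrite expr0 mulr1 enorm_sqr.
  apply: le_trans (S_contr _ _) _; rewrite [r ^+ k.+1]exprS mulrCA exprMn.
  by rewrite ler_wpM2l ?sqr_ge0.
have coord_le (v : 'cV[R]_d) i : v i 0 ^+ 2 <= dot v v.
  rewrite /dot (bigD1 i) //= expr2 lerDl.
  by apply: sumr_ge0 => j _; rewrite -expr2 sqr_ge0.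
have /choice[p pP] i : exists p, forall k, `|z k i 0 - p| <= c / (1 - r) * r ^+ k.
  apply: geometric_cauchy => // k; rewrite -(@ler_pXn2r _ 2) ?nnegrE ?mulr_ge0 ?exprn_ge0 //.
  rewrite real_normK ?num_real // (le_trans _ (zS k)) // (le_trans _ (coord_le _ i)) //.
  by rewrite !mxE.
pose zlim : 'cV[R]_d := \col_i p i; exists zlim.
have dist_lim k : dot (z k - zlim) (z k - zlim) <= d%:R * (c / (1 - r)) ^+ 2 * (r ^+ 2) ^+ k.
  have expand (C : R) : d%:R * C ^+ 2 * (r ^+ 2) ^+ k = \sum_(i < d) (C * r ^+ k) ^+ 2.
    by rewrite sumr_const card_ord -[RHS]mulr_natl (exprAC r) [in RHS]exprMn [RHS]mulrA.
  rewrite expand.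
  apply: ler_sum => i _; rewrite -expr2 -[leLHS](real_normK (num_real _)).
  have Crk : 0 <= c / (1 - r) * r ^+ k by rewrite mulr_ge0 ?exprn_ge0 // divr_ge0 //; lra.
  by rewrite ler_pXn2r ?nnegrE // !mxE.
set D := d%:R * _ in dist_lim.
apply/eqP; rewrite -subr_eq0 -dot_eq0; apply/eqP.
(* Through the iterate [z k.+1], the defect splits into two vectors of squared length at most
   [D * (r ^+ 2) ^+ k]; the square of their sum is at most twice the total. *)
apply: (@geometric_bound_eq0 _ _ (4 * D) (r ^+ 2)); first exact: dot_ge0.
  by rewrite sqr_ge0 expr_lt1.
move=> k; have := dist_lim k; have := dist_lim k.+1; have := S_contr zlim (z k).
rewrite -[S (z k)]/(z k.+1).
have -> : S zlim - zlim = (S zlim - z k.+1) + (z k.+1 - zlim) by colring.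
move: (S zlim - z k.+1) (z k.+1 - zlim) => a b.
have -> : zlim - z k = - (z k - zlim) by rewrite opprB.
move: (z k - zlim) => e; rewrite dotNl dotNr opprK => H1 H2 H3.
have q1 : r ^+ 2 <= 1 by rewrite expr_le1 // ltW.
have e_le : dot a a <= D * (r ^+ 2) ^+ k.
  apply: le_trans H1 _; apply: le_trans H3; rewrite -[leRHS]mul1r.
  by rewrite ler_wpM2r ?dot_ge0.
have b_le : dot b b <= D * (r ^+ 2) ^+ k.
  apply: le_trans H2 _; rewrite exprS mulrCA -[leRHS]mul1r ler_wpM2r //.
  exact: le_trans (dot_ge0 _) H3.
by have := dot_ge0 (a - b); rewrite !dotE (dotC b a); lra.
Qed.

(** The Gram formula [r^T (r r^T)^-1 r], with [r] a basis of the row space of [B]: its rows are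
    independent even when those of [B] are not. *)
Lemma range_projector (R : realType) (m n : nat) (B : 'M[R]_(m, n)) :
  exists Pi : 'M[R]_n, [/\ Pi^T = Pi, Pi *m Pi = Pi, B *m Pi = B
    & forall v : 'cV[R]_n, range (mulmx B^T) (Pi *m v)].
Proof.
have [k [r [N1 [N2 [free_r BN rN]]]]] : exists k (r : 'M[R]_(k, n)) N1 N2,
    [/\ row_free r, B = N1 *m r & r = N2 *m B].
  have /submxP[N1 BN] : (B <= row_base B)%MS by rewrite eq_row_base.
  have /submxP[N2 rN] : (row_base B <= B)%MS by rewrite eq_row_base.
  by exists (\rank B), (row_base B), N1, N2; rewrite row_base_free.
set G := r *m r^T.
have unitG : G \in unitmx.
  rewrite -row_free_unit -kermx_eq0; apply/negPn/negP => /rowV0Pn[v].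
  move=> /sub_kermxP vG v0; pose u := v *m r.
  have u0 : u^T = 0.
    apply/eqP; rewrite -dot_eq0 [dot _ _](_ : _ = (u *m u^T) 0 0).
      by rewrite trmx_mul mulmxA -(mulmxA v) vG mul0mx mxE.
    by rewrite mxE; apply: eq_bigr => i _; rewrite !mxE.
  have /row_freeP[r' rr'] := free_r.
  move/negP: v0; apply; rewrite -[v]mulmx1 -rr' mulmxA -/u.
  by rewrite -[u]trmxK u0 trmx0 mul0mx.
have symG : G^T = G by rewrite trmx_mul trmxK.
exists (r^T *m invmx G *m r); split=> [|||v].
- rewrite !trmx_mul trmxK trmx_inv symG. by rewrite mulmxA.
- by rewrite -!mulmxA (mulmxA r r^T) -/G mulKVmx ?(mulmxA _ _ r) // mulKmx.
- by rewrite {1}BN -!mulmxA (mulmxA r r^T) -/G mulKVmx.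
- by exists (N2^T *m (invmx G *m (r *m v))) => //; rewrite mulmxA -trmx_mul -rN !mulmxA.
Qed.

Lemma eigenvalue_sym (R : realType) (n : nat) (A : 'M[R]_n) (a : R) : A^T = A ->
  eigenvalue A a <-> exists2 w : 'cV[R]_n, w != 0 & A *m w = a *: w.
Proof.
move=> symA; split=> [/eigenvalueP[v vA v0]|[w w0 Aw]].
  by exists v^T; rewrite ?trmx_eq0 // -[A]symA -trmx_mul vA linearZ.
by apply/eigenvalueP; exists w^T; rewrite ?trmx_eq0 // -[A]symA -trmx_mul Aw linearZ.
Qed.

(* B^T B + mu (1 - Pi) has no eigenvalue below mu: outside the range of Pi the second term
   contributes mu, and inside it the kernel of B is trivial. *)
Lemma lambda_min_pos_coercive (R : realType) (m n : nat) (B : 'M[R]_(m, n))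
    (Pi : 'M[R]_n) (mu : R) :
  Pi^T = Pi -> Pi *m Pi = Pi -> B *m Pi = B ->
  (forall v : 'cV[R]_n, range (mulmx B^T) (Pi *m v)) ->
  (mu%:E <= lambda_min_pos (B^T *m B))%E ->
  forall v, mu * dot (Pi *m v) (Pi *m v) <= dot (B *m v) (B *m v).
Proof.
move=> symPi idPi BPi rangePi mu_le v.
have PiBt : Pi *m B^T = B^T by rewrite -[in RHS]BPi trmx_mul symPi.
have symBB : (B^T *m B)^T = B^T *m B by rewrite trmx_mul trmxK.
pose A := B^T *m B + mu *: (1%:M - Pi).
have symA : A^T = A by rewrite linearD linearZ /= linearB /= symBB trmx1 symPi.
have := @rayleigh_ge _ _ A mu symA; rewrite /A => /(_ _ (Pi *m v)).
have -> : (B^T *m B + mu *: (1%:M - Pi)) *m (Pi *m v) = B^T *m (B *m v).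
  rewrite mulmxDl -scalemxAl mulmxBl mul1mx (mulmxA Pi) idPi subrr scaler0 addr0.
  by rewrite -mulmxA (mulmxA B) BPi.
rewrite (dot_trmx B^T) trmxK (mulmxA B) BPi; apply=> a /(eigenvalue_sym _ symA)[w w0 Aw].
rewrite leNgt; apply/negP => a_lt.
have PiAw : B^T *m (B *m w) = a *: (Pi *m w).
  have := congr1 (mulmx Pi) Aw; rewrite -scalemxAr => <-.
  rewrite mulmxDl mulmxDr -!mulmxA (mulmxA Pi B^T) PiBt -scalemxAl -scalemxAr.
  by rewrite mulmxBl mul1mx mulmxBr (mulmxA Pi Pi) idPi subrr scaler0 addr0.
have wPi : Pi *m w = w.
  have : (mu - a) *: (w - Pi *m w) = 0.
    have := Aw; rewrite mulmxDl -mulmxA PiAw -scalemxAl mulmxBl mul1mx => H.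
    by rewrite scalerBl [a *: (_ - _)]scalerBr -H; colring.
  by move/eqP; rewrite scaler_eq0 subr_eq0 gt_eqF //= subr_eq0 => /eqP.
have a_dot : a * dot w w = dot (B *m w) (B *m w).
  by rewrite dot_trmx PiAw wPi dotZr.
have w_gt0 : 0 < dot w w by rewrite dot_gt0.
have a_gt0 : 0 < a.
  rewrite -(pmulr_lgt0 _ w_gt0) a_dot dot_gt0; apply: contraNneq w0 => Bw.
  have [u _ uE] := rangePi w; rewrite -dot_eq0 -{1}wPi -uE.
  by rewrite dot_trmx trmxK Bw dot0r.
have : (mu%:E <= a%:E)%E.
  apply: le_trans mu_le _; apply: ereal_inf_lbound; exists a => //; split=> //.
  by apply/(eigenvalue_sym _ symBB); exists w; rewrite // -mulmxA PiAw wPi.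
by rewrite lee_fin leNgt a_lt.
Qed.

Lemma lambda_min_coercive (R : realType) (m n : nat) (B : 'M[R]_(m, n)) (mu : R) :
  (mu%:E <= lambda_min (B^T *m B))%E ->
  forall v, mu * dot v v <= dot (B *m v) (B *m v).
Proof.
move=> mu_le v; rewrite dot_trmx dotC mulmxA; apply: rayleigh_ge.
  by rewrite trmx_mul trmxK.
move=> a eig_a; rewrite -lee_fin; apply: le_trans mu_le _.
by apply: ereal_inf_lbound; exists a.
Qed.

(** The upper bound from [x] and the lower bound from [x'] are compared at [x - l^-1 *: e], a
    gradient step from [x] for [h] minus its linear part at [x']. *)
Lemma cocoercive (R : realType) (d : nat) (h : 'cV[R]_d -> R) (G : 'cV[R]_d -> 'cV[R]_d) (l : R) :
  0 < l ->
  (forall z w, 0 <= h w - h z - dot (G z) (w - z) <= l / 2 * dot (w - z) (w - z)) ->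
  forall x x', dot (G x - G x') (G x - G x') <= 2 * l * (h x - h x' - dot (G x') (x - x')).
Proof.
move=> l0 hG x x'; set e := G x - G x'.
have /andP[lo _] := hG x' (x - l^-1 *: e); have /andP[_ up] := hG x (x - l^-1 *: e).
have ux : x - l^-1 *: e - x = - (l^-1 *: e) by colring.
have ux' : x - l^-1 *: e - x' = (x - x') - l^-1 *: e by colring.
have ee : dot e e = dot (G x) e - dot (G x') e by rewrite {1}/e dotDl dotNl.
rewrite ux ux' in lo up; rewrite !(dotNr, dotNl, dotZr, dotZl) in up.
rewrite dotDr dotNr dotZr in lo.
have lVV : l / 2 * (l^-1 * (l^-1 * dot e e)) = l^-1 * dot e e / 2 by field; lra.
have VE : l^-1 * dot e e = l^-1 * dot (G x) e - l^-1 * dot (G x') e by rewrite {1}ee mulrBr.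
have D_ge : l^-1 * dot e e / 2 <= h x - h x' - dot (G x') (x - x') by lra.
have -> : dot e e = 2 * l * (l^-1 * dot e e / 2) by field; lra.
by rewrite ler_pM2l //; lra.
Qed.

(* Pi is the identity if grad h leaves the range of B^T, and the orthogonal projection onto that
   range otherwise. *)
Definition compatible (R : realType) (m n : nat) (h : 'cV[R]_n -> R) (B : 'M[R]_(m, n))
    (mu : R) (Pi : 'M[R]_n) :=
  [/\ Pi^T = Pi, Pi *m Pi = Pi, B *m Pi = B, forall x, Pi *m grad h x = grad h x
    & forall v, mu ^+ 2 * dot (Pi *m v) (Pi *m v) <= dot (B *m v) (B *m v)].

Lemma compatible_exists (R : realType) (m n : nat) (h : 'cV[R]_n -> R) (B : 'M[R]_(m, n)) (mu : R) :
  let grad_in_range := forall x, range (mulmx B^T) (grad h x) in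
  (grad_in_range -> ((mu ^+ 2)%:E <= lambda_min_pos (B^T *m B))%E) ->
  (~ grad_in_range -> ((mu ^+ 2)%:E <= lambda_min (B^T *m B))%E) ->
  exists Pi, compatible h B mu Pi.
Proof.
move=> grad_in_range lam_pos lam; have [in_range|not_in_range] := pselect grad_in_range.
  have [Pi [symPi idPi BPi rangePi]] := range_projector B; exists Pi; split=> //.
    by move=> x; have [w _ <-] := in_range x; rewrite mulmxA -[Pi]symPi -trmx_mul BPi.
  exact: lambda_min_pos_coercive (lam_pos in_range).
exists 1%:M; split; rewrite ?trmx1 ?mulmx1 // => v; rewrite mul1mx //.
exact: lambda_min_coercive (lam not_in_range) v.
Qed.

Lemma proj_sqr_le (R : realType) (n : nat) (Pi : 'M[R]_n) v : Pi^T = Pi -> Pi *m Pi = Pi ->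
  dot (Pi *m v) (Pi *m v) <= dot v v.
Proof.
move=> symPi idPi; have := dot_ge0 (v - Pi *m v).
rewrite !dotE (dotC (Pi *m v) v).
have -> : dot (Pi *m v) (Pi *m v) = dot v (Pi *m v) by rewrite dot_trmx symPi mulmxA idPi.
lra.
Qed.

Section Saddle.
Variables (R : realType) (dx dy : nat).
Variables (f : 'cV[R]_dx -> R) (g : 'cV[R]_dy -> R) (B : 'M[R]_(dy, dx)).
Variables (par : params R) (Pix : 'M[R]_dx) (Piy : 'M[R]_dy).
Hypothesis par_ok : conditions par.
Hypothesis reg_ok : regular f g B par.
Hypothesis Pix_ok : compatible f B (muxy par) Pix.
Hypothesis Piy_ok : compatible g B^T (muyx par) Piy.

Let Lx0 : 0 < Lx par := Lx_gt0 par_ok.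
Let Ly0 : 0 < Ly par := Ly_gt0 par_ok.
Let s := (Ly par)^-1.
Let r := (Lx par)^-1.
Let s0 : 0 < s. Proof. by rewrite invr_gt0. Qed.
Let r0 : 0 < r. Proof. by rewrite invr_gt0. Qed.

(* The field (grad f x + B^T y, grad g y - B x) premultiplied by the invertible matrix
   [1, - s B^T; r B, 1]; on the ranges of Pix and Piy it is strongly monotone. *)
Definition field_x x y : 'cV[R]_dx :=
  grad f x + B^T *m y + s *: (B^T *m (B *m x - grad g y)).

Definition field_y x y : 'cV[R]_dy :=
  grad g y - B *m x + r *: (B *m (B^T *m y + grad f x)).

Lemma field_xB x x' y y' : field_x x y - field_x x' y' =
  (grad f x - grad f x') + B^T *m (y - y') + s *: (B^T *m (B *m (x - x') - (grad g y - grad g y'))).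
Proof.
rewrite /field_x (_ : B *m (x - x') - _ = (B *m x - grad g y) - (B *m x' - grad g y')).
  move: (B *m x - grad g y) (B *m x' - grad g y') => a a'; rewrite !mulmxBr.
  move: (B^T *m a) (B^T *m a') (B^T *m y) (B^T *m y') => *; colring.
by rewrite mulmxBr; move: (B *m x) (B *m x') => *; colring.
Qed.

Lemma field_yB x x' y y' : field_y x y - field_y x' y' =
  (grad g y - grad g y') - B *m (x - x') + r *: (B *m (B^T *m (y - y') + (grad f x - grad f x'))).
Proof.
rewrite /field_y (_ : B^T *m (y - y') + _ = (B^T *m y + grad f x) - (B^T *m y' + grad f x')).
  move: (B^T *m y + grad f x) (B^T *m y' + grad f x') => a a'; rewrite !mulmxBr.
  move: (B *m a) (B *m a') (B *m x) (B *m x') => *; colring.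
by rewrite mulmxBr; move: (B^T *m y) (B^T *m y') => *; colring.
Qed.

Lemma f_cocoercive x x' : dot (grad f x - grad f x') (grad f x - grad f x') <=
  2 * Lx par * (f x - f x' - dot (grad f x') (x - x')).
Proof. exact: cocoercive (f_bregman reg_ok) x x'. Qed.

Lemma g_cocoercive y y' : dot (grad g y - grad g y') (grad g y - grad g y') <=
  2 * Ly par * (g y - g y' - dot (grad g y') (y - y')).
Proof. exact: cocoercive (g_bregman reg_ok) y y'. Qed.

Lemma f_strong x x' : mux par / 2 * dot (x - x') (x - x') <=
  f x - f x' - dot (grad f x') (x - x').
Proof. by case: reg_ok => _ [_ + _] _ _ _ => /(_ x x'); rewrite enorm_sqr. Qed.

Lemma g_strong y y' : muy par / 2 * dot (y - y') (y - y') <=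
  g y - g y' - dot (grad g y') (y - y').
Proof. by case: reg_ok => _ _ [_ + _] _ _ => /(_ y y'); rewrite enorm_sqr. Qed.

(** The skew terms cancel. Half of the monotonicity of the gradients, by cocoercivity, and half of
    the squares of [B] and [B^T] pay for the cross terms; the other halves leave [delta_x / 2] and
    [delta_y / 2]. *)
Lemma field_strongly_monotone x x' y y' :
  Pix *m (x - x') = x - x' -> Piy *m (y - y') = y - y' ->
  delta_x par / 2 * dot (x - x') (x - x') + delta_y par / 2 * dot (y - y') (y - y') <=
  dot (field_x x y - field_x x' y') (x - x') + dot (field_y x y - field_y x' y') (y - y').
Proof.
have [_ _ _ _ Bx_ge] := Pix_ok; have [_ _ _ _ By_ge] := Piy_ok.
move=> Px Py; have := Bx_ge (x - x'); have := By_ge (y - y'); rewrite Px Py.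
have Dx : (f x - f x' - dot (grad f x') (x - x')) + (f x' - f x - dot (grad f x) (x' - x)) =
    dot (grad f x - grad f x') (x - x') by rewrite -(opprB x x') !dotE; ring.
have Dy : (g y - g y' - dot (grad g y') (y - y')) + (g y' - g y - dot (grad g y) (y' - y)) =
    dot (grad g y - grad g y') (y - y') by rewrite -(opprB y y') !dotE; ring.
have := f_cocoercive x x'; have := f_cocoercive x' x; have := f_strong x x'; have := f_strong x' x.
have := g_cocoercive y y'; have := g_cocoercive y' y; have := g_strong y y'; have := g_strong y' y.
move: Dx Dy.
rewrite field_xB field_yB.
rewrite -(opprB x x') -(opprB y y') -(opprB (grad f x)) -(opprB (grad g y)).
move: (f x - f x' - _) (f x' - f x - _) (g y - g y' - _) (g y' - g y - _) => Dx Dx' Dy Dy'.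
move: (x - x') (y - y') (grad f x - grad f x') (grad g y - grad g y') => u v df dg.
have adj_x w : dot (B^T *m w) u = dot w (B *m u) by rewrite dot_trmx trmxK.
have adj_y w : dot (B *m w) v = dot w (B^T *m v) by rewrite dot_trmx.
have adj : dot v (B *m u) = dot u (B^T *m v) by rewrite dotC adj_y.
rewrite !(dotDl _ _ u) !(dotDl _ _ v) !dotZl (dotNl _ v) !adj_x !adj_y adj.
move: (B *m u) (B^T *m v) (dot u (B^T *m v)) => p q uq.
rewrite !(dotNl, dotNr) !opprK (dotDl _ _ p) (dotDl _ _ q) (dotNl _ p).
move=> DxE DyE gs' gs gc' gc fs' fs fc' fc vq up.
have df_le : r * dot df df <= dot df u.
  by rewrite mulrC ler_pdivrMr // -DxE; lra.
have dg_le : s * dot dg dg <= dot dg v.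
  by rewrite mulrC ler_pdivrMr // -DyE; lra.
have cross_x : 0 <= r * dot (df + q) (df + q) by rewrite mulr_ge0 ?dot_ge0 // ltW.
have cross_y : 0 <= s * dot (dg - p) (dg - p) by rewrite mulr_ge0 ?dot_ge0 // ltW.
rewrite !dotE (dotC q df) (dotC p dg) in cross_x cross_y.
have sup : s * (muxy par ^+ 2 * dot u u) <= s * dot p p by rewrite ler_wpM2l // ltW.
have rvq : r * (muyx par ^+ 2 * dot v v) <= r * dot q q by rewrite ler_wpM2l // ltW.
by rewrite /delta_x /delta_y -/s -/r; move: df_le dg_le; lra.
Qed.

Lemma dotD3_le (d : nat) (a b c : 'cV[R]_d) :
  dot (a + b + c) (a + b + c) <= 3 * (dot a a + dot b b + dot c c).
Proof.
have := dot_ge0 (a - b); have := dot_ge0 (b - c); have := dot_ge0 (a - c).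
by rewrite !dotE (dotC b a) (dotC c a) (dotC c b); lra.
Qed.

Lemma dotD_le (d : nat) (a b : 'cV[R]_d) : dot (a + b) (a + b) <= 2 * (dot a a + dot b b).
Proof. by have := dot_ge0 (a - b); rewrite !dotE (dotC b a); lra. Qed.

Lemma field_lipschitz : exists2 l : R, 0 < l & forall x x' y y',
  dot (field_x x y - field_x x' y') (field_x x y - field_x x' y')
  + dot (field_y x y - field_y x' y') (field_y x y - field_y x' y') <=
  l * (dot (x - x') (x - x') + dot (y - y') (y - y')).
Proof.
pose K := Lxy par ^+ 2.
have K0 : 0 <= K := sqr_ge0 _.
have Lx2 := sqr_ge0 (Lx par); have Ly2 := sqr_ge0 (Ly par).
pose cx := s ^+ 2 * K * 2 * (K + Ly par ^+ 2); pose cy := r ^+ 2 * K * 2 * (K + Lx par ^+ 2).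
have coef_ge0 (a b : R) : 0 <= b -> 0 <= a ^+ 2 * K * 2 * (K + b).
  by move=> b0; apply: mulr_ge0; [apply: mulr_ge0 => //; apply: mulr_ge0 => //; apply: sqr_ge0
                                 | apply: addr_ge0].
have cx0 : 0 <= cx by apply: coef_ge0.
have cy0 : 0 <= cy by apply: coef_ge0.
exists (1 + 3 * (Lx par ^+ 2 + Ly par ^+ 2 + 2 * K + cx + cy)) => [|x x' y y'].
  by rewrite ltr_pwDl //; apply: mulr_ge0 => //; do !apply: addr_ge0 => //; apply: mulr_ge0.
rewrite field_xB field_yB.
have df_le : dot (grad f x - grad f x') (grad f x - grad f x') <=
    Lx par ^+ 2 * dot (x - x') (x - x').
  apply: le_trans (f_cocoercive x x') _; have /andP[_ up] := f_bregman reg_ok x' x.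
  by rewrite -(ler_pM2l (x := 2 * Lx par)) ?mulr_gt0 // in up; lra.
have dg_le : dot (grad g y - grad g y') (grad g y - grad g y') <=
    Ly par ^+ 2 * dot (y - y') (y - y').
  apply: le_trans (g_cocoercive y y') _; have /andP[_ up] := g_bregman reg_ok y' y.
  by rewrite -(ler_pM2l (x := 2 * Ly par)) ?mulr_gt0 // in up; lra.
move: df_le dg_le.
move: (x - x') (y - y') (grad f x - grad f x') (grad g y - grad g y') => u v df dg df_le dg_le.
have u0 := dot_ge0 u; have v0 := dot_ge0 v.
have p_le : dot (B *m u) (B *m u) <= K * dot u u := mulmx_B_le reg_ok u.
have q_le : dot (B^T *m v) (B^T *m v) <= K * dot v v := mulmx_Btr_le reg_ok v.
have x_le : dot (s *: (B^T *m (B *m u - dg))) (s *: (B^T *m (B *m u - dg))) <=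
    cx * (dot u u + dot v v).
  rewrite dotZl dotZr mulrA -expr2.
  have -> : cx * (dot u u + dot v v) =
      s ^+ 2 * (K * (2 * ((K + Ly par ^+ 2) * (dot u u + dot v v)))) by rewrite /cx; ring.
  apply: (ler_wpM2l (sqr_ge0 _)); apply: le_trans (mulmx_Btr_le reg_ok _) _.
  apply: (ler_wpM2l K0); apply: le_trans (dotD_le _ _) _; rewrite ler_wpM2l // dotNl dotNr opprK.
  have : 0 <= K * dot v v by apply: mulr_ge0.
  have : 0 <= Ly par ^+ 2 * dot u u by apply: mulr_ge0.
  lra.
have y_le : dot (r *: (B *m (B^T *m v + df))) (r *: (B *m (B^T *m v + df))) <=
    cy * (dot u u + dot v v).
  rewrite dotZl dotZr mulrA -expr2.
  have -> : cy * (dot u u + dot v v) =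
      r ^+ 2 * (K * (2 * ((K + Lx par ^+ 2) * (dot u u + dot v v)))) by rewrite /cy; ring.
  apply: (ler_wpM2l (sqr_ge0 _)); apply: le_trans (mulmx_B_le reg_ok _) _.
  apply: (ler_wpM2l K0); apply: le_trans (dotD_le _ _) _; rewrite ler_wpM2l //.
  have : 0 <= K * dot u u by apply: mulr_ge0.
  have : 0 <= Lx par ^+ 2 * dot v v by apply: mulr_ge0.
  lra.
have := dotD3_le df (B^T *m v) (s *: (B^T *m (B *m u - dg))).
have := dotD3_le dg (- (B *m u)) (r *: (B *m (B^T *m v + df))).
rewrite (dotNl (B *m u)) (dotNr (B *m u)) (opprK (dot _ _)).
have := mulr_ge0 Lx2 v0; have := mulr_ge0 Ly2 u0; have := mulr_ge0 K0 u0; have := mulr_ge0 K0 v0.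
move: x_le y_le df_le dg_le p_le q_le.
move: (dot u u) (dot v v) u0 v0 => uu vv u0 v0.
move: (dot (s *: _) _) (dot (r *: _) _) (dot df df) (dot dg dg) => sx sy dff dgg.
move: (dot (B *m u) _) (dot (B^T *m v) _) => p q.
clearbody cx cy K.
lra.
Qed.

(** A small projected step against the field is a contraction of the whole space; the field vanishes
    at its fixed point. *)
Lemma saddle_exists : exists x y, grad f x = - (B^T *m y) /\ grad g y = B *m x.
Proof.
have [symPx idPx BPx gradPx _] := Pix_ok; have [symPy idPy BPy gradPy _] := Piy_ok.
have PxBt : Pix *m B^T = B^T by rewrite -[Pix]symPx -trmx_mul BPx.
have PyB : Piy *m B = B by rewrite -[Piy]symPy -[B in LHS]trmxK -trmx_mul BPy trmxK.
have Px_field x y : Pix *m field_x x y = field_x x y.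
  by rewrite /field_x !(mulmxDr Pix) gradPx -scalemxAr !(mulmxA Pix) PxBt.
have Py_field x y : Piy *m field_y x y = field_y x y.
  by rewrite /field_y !(mulmxDr Piy) mulmxN gradPy -scalemxAr !(mulmxA Piy) PyB.
have [l l0 lip] := field_lipschitz.
pose m := Num.min (delta_x par) (delta_y par).
have m0 : 0 < m by case: par_ok.
(* The minimizer of [q] in [tau]; enlarging [l] by [m ^+ 2] keeps [q] nonnegative without comparing
   [l] and [m]. *)
pose tau := m / (2 * (l + m ^+ 2)).
have lm0 : 0 < l + m ^+ 2 by rewrite ltr_wpDr ?sqr_ge0.
have tau0 : 0 < tau by rewrite divr_gt0 // mulr_gt0.
have [S [S_u S_d]] : exists S : 'cV[R]_(dx + dy) -> 'cV[R]_(dx + dy),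
    (forall z, usubmx (S z) = Pix *m usubmx z
       - tau *: field_x (Pix *m usubmx z) (Piy *m dsubmx z)) /\
    (forall z, dsubmx (S z) = Piy *m dsubmx z
       - tau *: field_y (Pix *m usubmx z) (Piy *m dsubmx z)).
  exists (fun z => col_mx
    (Pix *m usubmx z - tau *: field_x (Pix *m usubmx z) (Piy *m dsubmx z))
    (Piy *m dsubmx z - tau *: field_y (Pix *m usubmx z) (Piy *m dsubmx z))).
  by split=> z; rewrite ?col_mxKu ?col_mxKd.
pose q := 1 - tau * m + tau ^+ 2 * (l + m ^+ 2).
have qE : q = 1 - m ^+ 2 / (4 * (l + m ^+ 2)).
  by rewrite /q /tau; field; rewrite lt0r_neq0.
have q_ge0 : 0 <= q.
  rewrite qE subr_ge0 ler_pdivrMr ?mulr_gt0 // mul1r; have := sqr_ge0 m; lra.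
have q_lt1 : q < 1.
  by rewrite qE ltrBlDr ltrDl divr_gt0 ?exprn_gt0 ?mulr_gt0.
have usubmxB (a b : 'cV[R]_(dx + dy)) : usubmx (a - b) = usubmx a - usubmx b.
  by rewrite linearB.
have dsubmxB (a b : 'cV[R]_(dx + dy)) : dsubmx (a - b) = dsubmx a - dsubmx b.
  by rewrite linearB.
have [z zE] : exists z, S z = z.
  apply: (@contraction_fixed_point _ _ S (Num.sqrt q)).
    by rewrite sqrtr_ge0 -sqrtr1 ltr_sqrt.
  move=> z w; rewrite sqr_sqrtr // [dot (z - w) _]dot_vsub [dot (S z - S w) _]dot_vsub.
  rewrite !usubmxB !dsubmxB !S_u !S_d.
  have u_le := proj_sqr_le (usubmx z - usubmx w) symPx idPx.
  have v_le := proj_sqr_le (dsubmx z - dsubmx w) symPy idPy.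
  apply: le_trans (_ : q * (dot (Pix *m (usubmx z - usubmx w)) (Pix *m (usubmx z - usubmx w))
    + dot (Piy *m (dsubmx z - dsubmx w)) (Piy *m (dsubmx z - dsubmx w))) <= _); last first.
    by rewrite ler_wpM2l // lerD.
  rewrite !mulmxBr.
  set x := Pix *m usubmx z; set x' := Pix *m usubmx w.
  set y := Piy *m dsubmx z; set y' := Piy *m dsubmx w.
  have mono : delta_x par / 2 * dot (x - x') (x - x') + delta_y par / 2 * dot (y - y') (y - y') <=
    dot (field_x x y - field_x x' y') (x - x') + dot (field_y x y - field_y x' y') (y - y').
    by apply: field_strongly_monotone; rewrite mulmxBr /x /x' /y /y' !mulmxA ?idPx ?idPy.
  have := lip x x' y y'; move: mono.
  have -> : x - tau *: field_x x y - (x' - tau *: field_x x' y') =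
    (x - x') - tau *: (field_x x y - field_x x' y') by colring.
  have -> : y - tau *: field_y x y - (y' - tau *: field_y x' y') =
    (y - y') - tau *: (field_y x y - field_y x' y') by colring.
  have : m * dot (x - x') (x - x') <= delta_x par * dot (x - x') (x - x').
    by rewrite ler_wpM2r ?dot_ge0 // ge_min lexx.
  have : m * dot (y - y') (y - y') <= delta_y par * dot (y - y') (y - y').
    by rewrite ler_wpM2r ?dot_ge0 // ge_min lexx orbT.
  have := dot_ge0 (x - x'); have := dot_ge0 (y - y').
  move: (x - x') (y - y') (field_x x y - _) (field_y x y - _) => u v a b v0 u0 mv mu mono' lip'.
  rewrite !dotE (dotC u a) (dotC v b).
  have tau_mono : tau * (m * (dot u u + dot v v)) <= tau * (2 * (dot a u + dot b v)).
    by apply: (ler_wpM2l (ltW tau0)); lra.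
  have tau_lip : tau ^+ 2 * (dot a a + dot b b) <= tau ^+ 2 * ((l + m ^+ 2) * (dot u u + dot v v)).
    apply: (ler_wpM2l (sqr_ge0 _)); apply: le_trans lip' _.
    by rewrite ler_wpM2r ?addr_ge0 // lerDl sqr_ge0.
  rewrite /q; move: tau_mono tau_lip; lra.
pose x := usubmx z; pose y := dsubmx z.
have xE : x = Pix *m x - tau *: field_x (Pix *m x) (Piy *m y) by rewrite {1}/x -zE S_u.
have yE : y = Piy *m y - tau *: field_y (Pix *m x) (Piy *m y) by rewrite {1}/y -zE S_d.
(* The field takes values in the range of [Pix], so applying [Pix] to the fixed-point equation
   reproduces its right-hand side. *)
have Pxx : Pix *m x = x by rewrite {1}xE mulmxBr mulmxA idPx -scalemxAr Px_field -xE.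
have Pyy : Piy *m y = y by rewrite {1}yE mulmxBr mulmxA idPy -scalemxAr Py_field -yE.
rewrite Pxx Pyy in xE yE.
have fx0 : field_x x y = 0.
  have /eqP : tau *: field_x x y = 0 by rewrite -[LHS](subKr x) -xE subrr.
  by rewrite scaler_eq0 gt_eqF //= => /eqP.
have fy0 : field_y x y = 0.
  have /eqP : tau *: field_y x y = 0 by rewrite -[LHS](subKr y) -yE subrr.
  by rewrite scaler_eq0 gt_eqF //= => /eqP.
pose F := grad f x + B^T *m y; pose G := grad g y - B *m x.
have FG : F = s *: (B^T *m G).
  have fxE : field_x x y = F - s *: (B^T *m G).
    by rewrite /field_x -(opprB (grad g y)) mulmxN scalerN.
  by apply/eqP; rewrite -subr_eq0 -fxE fx0.
have GF : G = - (r *: (B *m F)).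
  have fyE : field_y x y = G + r *: (B *m F) by rewrite /field_y (addrC (B^T *m y)).
  by apply/eqP; rewrite -subr_eq0 opprK -fyE fy0.
have FF : dot F F = s * dot G (B *m F) by rewrite {1}FG dotZl dot_trmx trmxK.
have GG : dot G G = - (r * dot G (B *m F)) by rewrite {1}GF dotNl dotZl dotC.
(* The opposite signs in [FG] and [GF] make the mixed terms cancel; this is the invertibility of the
   multiplier. *)
have FG0 : r * dot F F + s * dot G G = 0 by rewrite FF GG; ring.
have F0 := mulr_ge0 (ltW r0) (dot_ge0 F); have G0 := mulr_ge0 (ltW s0) (dot_ge0 G).
have /eqP : r * dot F F = 0 by lra.
have /eqP : s * dot G G = 0 by lra.
rewrite !mulf_eq0 !dot_eq0 !gt_eqF //= subr_eq0 addr_eq0 => /eqP gy /eqP fx.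
by exists x, y.
Qed.

End Saddle.

(** * Solution sets and restarts *)

Lemma conjugate_ge (R : realType) (d : nat) (h : 'cV[R]_d -> R) u y :
  ((dot u y - h y)%:E <= Defs.conjugate h u)%E.
Proof. by apply: ereal_sup_ubound; exists y. Qed.

Lemma conjugate_grad (R : realType) (d : nat) (h : 'cV[R]_d -> R) y :
  (forall w, 0 <= h w - h y - dot (grad h y) (w - y)) ->
  Defs.conjugate h (grad h y) = (dot (grad h y) y - h y)%:E.
Proof.
move=> h_cvx; apply/eqP; rewrite eq_le conjugate_ge andbT.
apply: ge_ereal_sup => _ [w _ <-]; rewrite lee_fin.
by have := h_cvx w; rewrite dotDr dotNr; lra.
Qed.

(** * The primal solution set and the distance to it; the dual one follows by exchanging roles *)

Section SolutionSet.
Variables (R : realType) (m n : nat) (f : 'cV[R]_n -> R) (g : 'cV[R]_m -> R).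
Variables (B : 'M[R]_(m, n)) (Pi : 'M[R]_n) (mu nu l : R) (xs : 'cV[R]_n) (ys : 'cV[R]_m).
Hypothesis l_gt0 : 0 < l.
Hypothesis mu_ge0 : 0 <= mu.
Hypothesis modulus_gt0 : 0 < mu + nu ^+ 2 / l.
Hypothesis f_strong : forall x x',
  mu / 2 * dot (x' - x) (x' - x) <= f x' - f x - dot (grad f x) (x' - x).
Hypothesis g_smooth : forall y y',
  0 <= g y' - g y - dot (grad g y) (y' - y) <= l / 2 * dot (y' - y) (y' - y).
Hypothesis Pi_ok : compatible f B nu Pi.
Hypothesis f_saddle : grad f xs = - (B^T *m ys).
Hypothesis g_saddle : grad g ys = B *m xs.
Implicit Types (x v : 'cV[R]_n) (y : 'cV[R]_m).

Lemma f_gradient_le x x' : 0 <= f x' - f x - dot (grad f x) (x' - x).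
Proof. by apply: le_trans (f_strong x x'); rewrite mulr_ge0 ?dot_ge0 // divr_ge0. Qed.

(** The displacement is orthogonal to the gradients at both endpoints, and convexity at each
    endpoint gives one inequality. *)
Lemma shift_invariant x v : f (x + (v - Pi *m v)) = f x.
Proof.
have [symPi idPi _ gradPi _] := Pi_ok; set w := v - Pi *m v.
have grad_w z : dot (grad f z) w = 0.
  rewrite -gradPi dot_trmx symPi /w mulmxBr mulmxA idPi subrr; exact: dot0r.
have := f_gradient_le x (x + w); have := f_gradient_le (x + w) x.
have -> : x + w - x = w by colring.
have -> : x - (x + w) = - w by colring.
by rewrite dotNr !grad_w; lra.
Qed.

Lemma mulmx_shift x v : B *m (x + (v - Pi *m v)) = B *m x.
Proof. by have [_ _ BPi _ _] := Pi_ok; rewrite mulmxDr mulmxBr mulmxA BPi subrr addr0. Qed.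

Lemma primal_saddle : primal f g B xs = (f xs + (dot (B *m xs) ys - g ys))%:E.
Proof.
rewrite /primal -g_saddle conjugate_grad // => w; by case/andP: (g_smooth ys w).
Qed.

Lemma primal_ge x y : ((f x + (dot (B *m x) y - g y))%:E <= primal f g B x)%E.
Proof. by rewrite EFinD; apply: leeD2l; apply: conjugate_ge. Qed.

Lemma Sx_saddle x : B *m x = B *m xs -> f x = f xs -> Sx f g B x.
Proof.
move=> Bx fx x'; rewrite /primal Bx fx -/(primal f g B xs) primal_saddle.
apply: le_trans (primal_ge x' ys); rewrite lee_fin.
have := f_gradient_le xs x'.
by rewrite f_saddle dotNl dot_trmx trmxK mulmxBr dotC dotDl dotNl; lra.
Qed.

(** Optimality forces both [mu] and [nu ^+ 2] times the squared length of the projection to vanish;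
    [modulus_gt0] makes one of these coefficients positive. *)
Lemma Sx_proj x : Sx f g B x -> Pi *m (x - xs) = 0.
Proof.
have [_ _ _ _ B_ge] := Pi_ok; have [symPi idPi _ _ _] := Pi_ok.
move=> x_min; have x_le y : f x + (dot (B *m x) y - g y) <= f xs + (dot (B *m xs) ys - g ys).
  by rewrite -lee_fin -primal_saddle; apply: le_trans (primal_ge x y) (x_min xs).
set e := B *m x - B *m xs.
have f_ge := f_strong xs x.
have grad_x : dot (grad f xs) (x - xs) = - dot ys e.
  by rewrite f_saddle dotNl dot_trmx trmxK mulmxBr.
have ys_le := x_le ys.
have lV : l * l^-1 = 1 by rewrite mulfV ?lt0r_neq0.
have e0 : dot e e = 0.
  (* This point maximizes the lower bound on the conjugate of [g] that smoothness at [ys] provides;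
     the gain is [dot e e / (2 * l)]. *)
  have := x_le (ys + l^-1 *: e).
  have /andP[_] := g_smooth ys (ys + l^-1 *: e).
  have -> : ys + l^-1 *: e - ys = l^-1 *: e by colring.
  rewrite g_saddle !dotZr !dotZl dotDr dotZr.
  have : dot e e = dot (B *m x) e - dot (B *m xs) e by rewrite {1}/e dotDl dotNl.
  have := f_gradient_le xs x; rewrite grad_x.
  have : dot ys e = dot (B *m x) ys - dot (B *m xs) ys by rewrite dotC /e dotDl dotNl.
  have -> : l / 2 * (l^-1 * (l^-1 * dot e e)) = l^-1 * dot e e / 2 by field; rewrite lt0r_neq0.
  have := dot_ge0 e => ee0 ys_e f_le ee g_le x_le'.
  have : l^-1 * dot e e = l^-1 * dot (B *m x) e - l^-1 * dot (B *m xs) e by rewrite {1}ee mulrBr.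
  move=> Vee; have : l^-1 * dot e e <= 0 by lra.
  by rewrite pmulr_rle0 ?invr_gt0 // => ee_le; apply/eqP; rewrite eq_le ee_le ee0.
apply/eqP; rewrite -dot_eq0 eq_le dot_ge0 andbT -(pmulr_rle0 _ modulus_gt0).
have proj_le := proj_sqr_le (x - xs) symPi idPi.
have nu_le : nu ^+ 2 * dot (Pi *m (x - xs)) (Pi *m (x - xs)) <= 0.
  by have := B_ge (x - xs); rewrite (mulmxBr B) -/e e0.
have mu_le : mu * dot (Pi *m (x - xs)) (Pi *m (x - xs)) <= 0.
  have : mu * dot (Pi *m (x - xs)) (Pi *m (x - xs)) <= mu * dot (x - xs) (x - xs).
    by rewrite ler_wpM2l.
  have : dot ys e = dot (B *m x) ys - dot (B *m xs) ys by rewrite dotC /e dotDl dotNl.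
  by move: f_ge; rewrite grad_x; lra.
have : l^-1 * (nu ^+ 2 * dot (Pi *m (x - xs)) (Pi *m (x - xs))) <= 0.
  by rewrite pmulr_rle0 ?invr_gt0.
by rewrite mulrDl; lra.
Qed.

Lemma dist_Sx x : dist x (Sx f g B) = (enorm (Pi *m (x - xs)))%:E.
Proof.
have [symPi idPi _ _ _] := Pi_ok; apply/eqP; rewrite eq_le; apply/andP; split.
  apply: ereal_inf_lbound; exists (xs + (x - xs - Pi *m (x - xs))).
    by apply: Sx_saddle; rewrite ?mulmx_shift ?shift_invariant.
  by congr (enorm _)%:E; colring.
apply: le_ereal_inf_tmp => _ [x' Sx' <-]; rewrite lee_fin.
have -> : Pi *m (x - xs) = Pi *m (x - x').
  have -> : x - xs = (x - x') + (x' - xs) by colring.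
  by rewrite mulmxDr (Sx_proj Sx') addr0.
by apply: ler_wsqrtr; apply: proj_sqr_le.
Qed.

(** Moving [x] to [xs + Pi *m (x - xs)] changes neither [f] nor the linear term. *)
Lemma bregman_proj_le L x :
  (forall z w, f w - f z - dot (grad f z) (w - z) <= L / 2 * dot (w - z) (w - z)) ->
  f x - f xs - dot (grad f xs) (x - xs) <=
  L / 2 * dot (Pi *m (x - xs)) (Pi *m (x - xs)).
Proof.
have [symPi idPi _ gradPi _] := Pi_ok; move=> f_smooth.
have := f_smooth xs (x + (xs - x - Pi *m (xs - x))); rewrite shift_invariant.
have -> : x + (xs - x - Pi *m (xs - x)) - xs = Pi *m (x - xs).
  by rewrite -(opprB x xs) mulmxN; colring.
by rewrite -[in dot (grad f xs) (Pi *m _)]symPi -dot_trmx gradPi.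
Qed.

End SolutionSet.

Lemma Sy_Sx (R : realType) (dx dy : nat) (f : 'cV[R]_dx -> R) (g : 'cV[R]_dy -> R)
    (B : 'M[R]_(dy, dx)) : Sy f g B = Sx g f (- B^T).
Proof.
have dualE y : Defs.dual f g B y = (- primal g f (- B^T) y)%E.
  by rewrite /Defs.dual /primal mulNmx [in RHS]addeC fin_num_oppeD // [RHS]addeC.
by apply/seteqP; split=> y y_opt y'; have := y_opt y'; rewrite !dualE leeN2.
Qed.

(** * Decrease of the potential in one restart *)

Section Descent.
Variables (R : realType) (dx dy : nat).
Variables (f : 'cV[R]_dx -> R) (g : 'cV[R]_dy -> R) (B : 'M[R]_(dy, dx)).
Variables (par : params R) (Pix : 'M[R]_dx) (Piy : 'M[R]_dy).
Variables (xs : 'cV[R]_dx) (ys : 'cV[R]_dy).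
Hypothesis par_ok : conditions par.
Hypothesis reg_ok : regular f g B par.
Hypothesis Pix_ok : compatible f B (muxy par) Pix.
Hypothesis Piy_ok : compatible g B^T (muyx par) Piy.
Hypothesis f_saddle : grad f xs = - (B^T *m ys).
Hypothesis g_saddle : grad g ys = B *m xs.
Implicit Types (z : 'cV[R]_(dx + dy)).

Let Lx0 : 0 < Lx par := Lx_gt0 par_ok.
Let Ly0 : 0 < Ly par := Ly_gt0 par_ok.

Lemma f_strong_rev x x' : mux par / 2 * dot (x' - x) (x' - x) <=
  f x' - f x - dot (grad f x) (x' - x).
Proof. exact: f_strong reg_ok x' x. Qed.

Lemma g_strong_rev y y' : muy par / 2 * dot (y' - y) (y' - y) <=
  g y' - g y - dot (grad g y) (y' - y).
Proof. exact: g_strong reg_ok y' y. Qed.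

Lemma Piy_okN : compatible g (- B^T) (muyx par) Piy.
Proof.
have [symP idP BP gradP B_ge] := Piy_ok; split=> // [|v]; first by rewrite mulNmx BP.
by rewrite mulNmx dotNl dotNr opprK.
Qed.

Lemma f_saddleN : grad f xs = - B^T *m ys. Proof. by rewrite mulNmx. Qed.

Lemma g_saddleN : grad g ys = - ((- B^T)^T *m xs).
Proof. by rewrite linearN /= trmxK mulNmx opprK. Qed.

Definition dist_x2 z := dot (Pix *m (usubmx z - xs)) (Pix *m (usubmx z - xs)).
Definition dist_y2 z := dot (Piy *m (dsubmx z - ys)) (Piy *m (dsubmx z - ys)).
Definition dist2 z := delta_x par * dist_x2 z + delta_y par * dist_y2 z.
Definition gap_f z := f (usubmx z) - f xs - dot (grad f xs) (usubmx z - xs).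
Definition gap_g z := g (dsubmx z) - g ys - dot (grad g ys) (dsubmx z - ys).

Lemma Rsq_dist2 z :
  Rsq f g B (delta_x par) (delta_y par) (usubmx z) (dsubmx z) = (dist2 z)%:E.
Proof.
rewrite /Rsq Sy_Sx.
rewrite (dist_Sx Ly0 (mux_ge0 par_ok) (delta_x_gt0 par_ok) f_strong_rev (g_bregman reg_ok)
  Pix_ok f_saddle g_saddle).
rewrite (dist_Sx Lx0 (muy_ge0 par_ok) (delta_y_gt0 par_ok) g_strong_rev (f_bregman reg_ok)
  Piy_okN g_saddleN f_saddleN).
by rewrite -!EFin_expe -!EFinM -EFinD !enorm_sqr.
Qed.

Lemma gap_f_ge z : mux par / 2 * dist_x2 z <= gap_f z.
Proof.
have [symP idP _ _ _] := Pix_ok; apply: le_trans (f_strong_rev _ _).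
by rewrite ler_wpM2l ?proj_sqr_le // divr_ge0 ?(mux_ge0 par_ok).
Qed.

Lemma gap_g_ge z : muy par / 2 * dist_y2 z <= gap_g z.
Proof.
have [symP idP _ _ _] := Piy_ok; apply: le_trans (g_strong_rev _ _).
by rewrite ler_wpM2l ?proj_sqr_le // divr_ge0 ?(muy_ge0 par_ok).
Qed.

Lemma gap_f_le z : gap_f z <= Lx par / 2 * dist_x2 z.
Proof.
apply: (bregman_proj_le xs (mux_ge0 par_ok) f_strong_rev Pix_ok) => x w.
by case/andP: (f_bregman reg_ok x w).
Qed.

Lemma gap_g_le z : gap_g z <= Ly par / 2 * dist_y2 z.
Proof.
apply: (bregman_proj_le ys (muy_ge0 par_ok) g_strong_rev Piy_ok) => y w.
by case/andP: (g_bregman reg_ok y w).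
Qed.

(** Here [a] belongs to the output, [a'] to the solution, and [b] is the data of [p_3]. By
    cocoercivity the subtracted term is at most a quarter of a Bregman distance of the input; the
    same loss occurs in [p_3] at the solution, whence the factor 1/2 in [descent_gap], where 1/24 is
    [3 * tol]. *)
Lemma residual_ge (n : nat) (a a' b : 'cV[R]_n) (L : R) : 0 < L ->
  dot (a - a') (a - a') / (16 * L) - (8 * L)^-1 * dot (b - a') (b - a') <=
  (8 * L)^-1 * dot (a - b) (a - b).
Proof.
move=> L0; rewrite (_ : _ / (16 * L) = (8 * L)^-1 * (dot (a - a') (a - a') / 2)); last first.
  by field; lra.
rewrite -mulrBr ler_pM2l ?invr_gt0 ?mulr_gt0 //.
rewrite (_ : a - a' = (a - b) + (b - a')); last by colring.
move: (a - b) (b - a') => u v; have := dot_ge0 (u - v); rewrite !dotE (dotC v u); lra.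
Qed.

(* The optimality gap is tested at the solution (x0, y0) nearest to zin; f, g, B and B^T do not
   distinguish (x0, y0) from (xs, ys). *)
Lemma descent_gap zin c (zout := (run f g B par zin c).1) : valid_schedule f g B par zin c ->
  gap_f zout + gap_g zout
  + dot (B *m usubmx zout - B *m xs) (B *m usubmx zout - B *m xs) / (16 * Ly par)
  + dot (B^T *m dsubmx zout - B^T *m ys) (B^T *m dsubmx zout - B^T *m ys) / (16 * Lx par)
  <= 2^-1 * (gap_f zin + gap_g zin) + 24^-1 * dist2 zin.
Proof.
case=> _ + _; rewrite -/zout.
have [symPx idPx BPx gradPx _] := Pix_ok; have [symPy idPy BPy gradPy _] := Piy_ok.
pose x0 := xs + (usubmx zin - xs - Pix *m (usubmx zin - xs)).
pose y0 := ys + (dsubmx zin - ys - Piy *m (dsubmx zin - ys)).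
move=> /(_ (col_mx x0 y0)).
have fx0 : f x0 = f xs := shift_invariant (mux_ge0 par_ok) f_strong_rev Pix_ok _ _.
have gy0 : g y0 = g ys := shift_invariant (muy_ge0 par_ok) g_strong_rev Piy_ok _ _.
have Bx0 : B *m x0 = B *m xs := mulmx_shift Pix_ok _ _.
have By0 : B^T *m y0 = B^T *m ys := mulmx_shift Piy_ok _ _.
rewrite mxnorm_of_sqr; last exact: inst_P_pd.
rewrite sqn_inst_P.
have usubB (a b : 'cV[R]_(dx + dy)) : usubmx (a - b) = usubmx a - usubmx b by rewrite linearB.
have dsubB (a b : 'cV[R]_(dx + dy)) : dsubmx (a - b) = dsubmx a - dsubmx b by rewrite linearB.
rewrite usubB dsubB col_mxKu col_mxKd.
have -> : usubmx zin - x0 = Pix *m (usubmx zin - xs) by rewrite /x0; colring.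
have -> : dsubmx zin - y0 = Piy *m (dsubmx zin - ys) by rewrite /y0; colring.
rewrite -/(dist_x2 zin) -/(dist_y2 zin) -/(dist2 zin).
rewrite !big_ord_recl !big_ord0 /inst_p /inst_Q /triple /= !add0r !addr0.
rewrite !col_mxKu !col_mxKd !enorm_sqr fx0 gy0 Bx0 By0 [dot (col_mx _ _) _]dot_vsub.
rewrite usubB dsubB !col_mxKu !col_mxKd.
have -> : dot (B^T *m ys) (usubmx zout - x0) = - dot (grad f xs) (usubmx zout - xs).
  by rewrite f_saddle dotNl opprK !dot_trmx trmxK !mulmxBr Bx0.
have -> : dot (- (B *m xs)) (dsubmx zout - y0) = - dot (grad g ys) (dsubmx zout - ys).
  by rewrite g_saddle dotNl !dot_trmx !mulmxBr By0.
have := residual_ge (B *m usubmx zout) (B *m xs) (grad g (dsubmx zin)) Ly0.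
have := residual_ge (B^T *m dsubmx zout) (B^T *m ys) (- grad f (usubmx zin)) Lx0.
have := f_cocoercive par_ok reg_ok (usubmx zin) xs.
have := g_cocoercive par_ok reg_ok (dsubmx zin) ys.
rewrite -/(gap_f zin) -/(gap_g zin) f_saddle g_saddle !opprK.
have -> : - grad f (usubmx zin) - B^T *m ys = - (B^T *m ys + grad f (usubmx zin)) by colring.
have -> : B *m xs - grad g (dsubmx zin) = - (grad g (dsubmx zin) - B *m xs) by rewrite opprB.
rewrite (addrC (grad f (usubmx zin))) !(dotNl (_ + _)) !(dotNr (_ + _)) !opprK.
move=> g_co f_co res_y res_x.
have {}g_co : (8 * Ly par)^-1 * dot (grad g (dsubmx zin) - B *m xs) (grad g (dsubmx zin) - B *m xs)
    <= gap_g zin / 4.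
  by rewrite ler_pdivrMl ?mulr_gt0 //; lra.
have {}f_co : (8 * Lx par)^-1 *
    dot (B^T *m ys + grad f (usubmx zin)) (B^T *m ys + grad f (usubmx zin))
    <= gap_f zin / 4.
  by rewrite ler_pdivrMl ?mulr_gt0 //; lra.
rewrite /tol /gap_f /gap_g in f_co g_co *.
rewrite f_saddle g_saddle in f_co g_co *.
lra.
Qed.

(** Adding 1/16 of [dist2_le_gap] to [descent_gap] leaves 7/8 of the output gaps and 1/16 of its
    [dist2]; multiplying by 8/7 gives the weight 1/14 and, on the right, 4/7 and 1/21, both at most
    2/3 of the weights 1 and 1/14. *)
Definition potential z := gap_f z + gap_g z + dist2 z / 14.

(** The [mux] and [muy] parts of the moduli come from strong convexity, the [muxy] and [muyx] parts
    from the residuals of [B] and [B^T]. *)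
Lemma dist2_le_gap z : dist2 z <=
  2 * (gap_f z + gap_g z)
  + dot (B *m usubmx z - B *m xs) (B *m usubmx z - B *m xs) / Ly par
  + dot (B^T *m dsubmx z - B^T *m ys) (B^T *m dsubmx z - B^T *m ys) / Lx par.
Proof.
have [_ _ _ _ Bx_ge] := Pix_ok; have [_ _ _ _ By_ge] := Piy_ok.
have gf := gap_f_ge z; have gg := gap_g_ge z.
have x_le : muxy par ^+ 2 * dist_x2 z / Ly par <=
    dot (B *m usubmx z - B *m xs) (B *m usubmx z - B *m xs) / Ly par.
  by rewrite ler_pM2r ?invr_gt0 // -mulmxBr; apply: Bx_ge.
have y_le : muyx par ^+ 2 * dist_y2 z / Lx par <=
    dot (B^T *m dsubmx z - B^T *m ys) (B^T *m dsubmx z - B^T *m ys) / Lx par.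
  by rewrite ler_pM2r ?invr_gt0 // -mulmxBr; apply: By_ge.
by rewrite /dist2 /delta_x /delta_y; move: x_le y_le; lra.
Qed.

Lemma gap_ge0 z : 0 <= gap_f z + gap_g z.
Proof.
apply: addr_ge0; first apply: le_trans (gap_f_ge z); last apply: le_trans (gap_g_ge z).
  by rewrite mulr_ge0 ?dot_ge0 // divr_ge0 ?(mux_ge0 par_ok).
by rewrite mulr_ge0 ?dot_ge0 // divr_ge0 ?(muy_ge0 par_ok).
Qed.

Lemma dist2_ge0 z : 0 <= dist2 z.
Proof.
by rewrite addr_ge0 // mulr_ge0 ?dot_ge0 // ltW ?(delta_x_gt0 par_ok) ?(delta_y_gt0 par_ok).
Qed.

Lemma potential_descent zin c : valid_schedule f g B par zin c ->
  potential (run f g B par zin c).1 <= 2 / 3 * potential zin.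
Proof.
move/descent_gap; set zout := (run _ _ _ _ _ _).1.
have := dist2_le_gap zout; have := gap_ge0 zin; have := dist2_ge0 zin.
rewrite /potential; have V16 (u L : R) : 0 < L -> u / (16 * L) = u / L / 16 by move=> ?; field; lra.
rewrite !V16 //; lra.
Qed.

Lemma potential_le z : 14 * potential z <= (7 * kappa_x par + 7 * kappa_y par + 1) * dist2 z.
Proof.
have gf := gap_f_le z; have gg := gap_g_le z; rewrite -(kappa_xE par_ok) in gf.
rewrite -(kappa_yE par_ok) in gg; have k1 := kappa_x_ge1 par_ok; have k2 := kappa_y_ge1 par_ok.
have x0 : 0 <= delta_x par * dist_x2 z by rewrite mulr_ge0 ?dot_ge0 // ltW ?(delta_x_gt0 par_ok).
have y0 : 0 <= delta_y par * dist_y2 z by rewrite mulr_ge0 ?dot_ge0 // ltW ?(delta_y_gt0 par_ok).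
have xy : 0 <= kappa_y par * (delta_x par * dist_x2 z) by apply: mulr_ge0 => //; lra.
have yx : 0 <= kappa_x par * (delta_y par * dist_y2 z) by apply: mulr_ge0 => //; lra.
by rewrite /potential /dist2; lra.
Qed.

Lemma restarted_dist2 c N : valid_schedules f g B par c ->
  dist2 (restarted f g B par c N) <=
  (2 / 3) ^+ N * ((1 + 12 * kappa_x par + 12 * kappa_y par) * dist2 0).
Proof.
move=> c_valid.
have pot : potential (restarted f g B par c N) <= (2 / 3) ^+ N * potential 0.
  elim: N => [|N IH]; first by rewrite expr0 mul1r.
  apply: le_trans (potential_descent (c_valid N)) _.
  by rewrite exprS -[leRHS]mulrA ler_wpM2l.
have gap0 := gap_ge0 (restarted f g B par c N).
have k1 := kappa_x_ge1 par_ok; have k2 := kappa_y_ge1 par_ok.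
have d_le : dist2 (restarted f g B par c N) <= (2 / 3) ^+ N * (14 * potential 0).
  by rewrite mulrCA; move: pot; rewrite {1}/potential; lra.
apply: le_trans d_le _; apply: ler_wpM2l; first by rewrite exprn_ge0.
apply: le_trans (potential_le 0) _; apply: ler_wpM2r; first exact: dist2_ge0.
lra.
Qed.

End Descent.

(** * Number of restarts and total cost *)

Lemma restart_count (R : realType) (X : R) : 3 / 2 <= X ->
  exists N : nat, (2 / 3) ^+ N * X <= 1 /\ N%:R <= 2 / ln (3 / 2) * ln X.
Proof.
move=> X_ge; have X0 : 0 < X by lra.
have a0 : 0 < ln (3 / 2 : R) by apply: ln_gt0; lra.
have lnX : ln (3 / 2) <= ln X by rewrite ler_ln ?posrE //; lra.
have t_ge1 : 1 <= ln X / ln (3 / 2) by rewrite ler_pdivlMr // mul1r.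
(* As [X] is at least 3/2, the quotient of logarithms is at least 1, and the factor 2 absorbs the
   extra restart due to rounding. *)
exists (Num.truncn (ln X / ln (3 / 2))).+1; split; last first.
  have : (Num.truncn (ln X / ln (3 / 2)))%:R <= ln X / ln (3 / 2) by rewrite truncn_le; lra.
  have -> : 2 / ln (3 / 2) * ln X = 2 * (ln X / ln (3 / 2)) by ring.
  by rewrite -[(Num.truncn _).+1%:R]natr1; lra.
set N := (Num.truncn _).+1.
have pow0 : 0 < (3 / 2 : R) ^+ N by rewrite exprn_gt0; lra.
have X_le : X <= (3 / 2) ^+ N.
  rewrite -ler_ln ?posrE // lnXn; last lra.
  by rewrite -[leRHS]mulr_natl -ler_pdivrMr //; apply: ltW; apply: truncnS_gt.
have -> : (2 / 3 : R) = (3 / 2)^-1 by field.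
by rewrite exprVn ler_pdivrMl // mulr1.
Qed.

Lemma budget_le (R : realType) (k m : R) : 1 <= k -> m <= Num.sqrt k ->
  Num.max (Num.sqrt (k / tol R)) (Num.max (m / tol R) 1) <= 72 * Num.sqrt k.
Proof.
move=> k1 mk; have s1 : 1 <= Num.sqrt k by rewrite -sqrtr1 ler_wsqrtr.
rewrite /tol invrK !ge_max; apply/and3P; split; try lra.
rewrite (_ : 72 * Num.sqrt k = Num.sqrt (k * 72 ^+ 2)); last first.
  by rewrite sqrtrM ?sqrtr_sqr; [rewrite (ger0_norm (ler0n _ _)) [RHS]mulrC | lra].
by apply: ler_wsqrtr; lra.
Qed.

Section CallCounts.
Variables (R : realType) (dx dy : nat).
Variables (f : 'cV[R]_dx -> R) (g : 'cV[R]_dy -> R) (B : 'M[R]_(dy, dx)).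
Variables (par : params R) (c : nat -> schedule) (N : nat).
Hypothesis par_ok : conditions par.
Hypothesis c_valid : valid_schedules f g B par c.

Lemma run_count_le t i (k : R) :
  Num.max (Num.sqrt (inst_L par i / tol R)) (Num.max (inst_M par i / tol R) 1) <= k ->
  (run_ngrad f g B par (restarted f g B par c t) (c t) i)%:R <= 6 ^+ 3 * k /\
  (run_nQ f g B par (restarted f g B par c t) (c t) i)%:R <= 6 ^+ 3 * k.
Proof.
move=> k_ge; have [_ _ /(_ i)[n_le q_le]] := c_valid t.
by split; [apply: le_trans n_le _ | apply: le_trans q_le _]; rewrite ler_wpM2l // exprn_ge0.
Qed.

Lemma sqrt_ge1 (k : R) : 1 <= k -> 1 <= Num.sqrt k.
Proof. by move=> k1; rewrite -sqrtr1 ler_wsqrtr. Qed.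

Lemma sum_count_le (F : nat -> nat) (k : R) : (forall t, (F t)%:R <= k) ->
  (\sum_(t < N) F t)%:R <= N%:R * k.
Proof.
move=> F_le; rewrite natr_sum; apply: (@le_trans _ _ (\sum_(t < N) k)).
  by apply: ler_sum => t _; apply: F_le.
by rewrite sumr_const card_ord mulr_natl.
Qed.

Lemma count_grad_f_le :
  (count_grad_f f g B par c N)%:R <= N%:R * (10 ^+ 5 * Num.sqrt (kappa_x par)).
Proof.
have k1 := kappa_x_ge1 par_ok; have s1 := sqrt_ge1 k1.
apply: (@sum_count_le (fun t => run_ngrad f g B par _ (c t) idx_f + 1)%N) => t.
have [n_le _] := run_count_le t (i := idx_f) (budget_le k1 (sqrtr_ge0 _)).
by rewrite natrD; lra.
Qed.

Lemma count_grad_g_le :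
  (count_grad_g f g B par c N)%:R <= N%:R * (10 ^+ 5 * Num.sqrt (kappa_y par)).
Proof.
have k1 := kappa_y_ge1 par_ok; have s1 := sqrt_ge1 k1.
apply: (@sum_count_le (fun t => run_ngrad f g B par _ (c t) idx_g + 1)%N) => t.
have [n_le _] := run_count_le t (i := idx_g) (budget_le k1 (sqrtr_ge0 _)).
by rewrite natrD; lra.
Qed.

(** Four multiplications per gradient and two per value of [Q_3]: at most [6 * 6 ^+ 3 * 72 = 93312]
    times [Num.sqrt (kappa_xy par)] per run. *)
Lemma count_matvec_le :
  (count_matvec f g B par c N)%:R <= N%:R * (10 ^+ 5 * Num.sqrt (kappa_xy par)).
Proof.
have k1 := kappa_xy_ge1 par_ok; have s1 := sqrt_ge1 k1.
apply: (@sum_count_le (fun t => 4 * run_ngrad f g B par _ (c t) idx_B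
                                + 2 * run_nQ f g B par _ (c t) idx_B)%N) => t.
have [n_le q_le] := run_count_le t (i := idx_B) (budget_le k1 (lexx _)).
by rewrite natrD !natrM; lra.
Qed.

End CallCounts.

Theorem corollary2 (R : realType) :
  exists K : R, 0 < K /\
  forall (dx dy : nat) (f : 'cV[R]_dx -> R) (g : 'cV[R]_dy -> R)
         (B : 'M[R]_(dy, dx)) (par : params R) (eps : R),
  let Rsq_xy := Rsq f g B (delta_x par) (delta_y par) in
  let R2 := Rsq_xy 0 0 in
  let cst := 1 + 12 * kappa_x par + 12 * kappa_y par in
  let logterm := ln (cst * fine R2 / eps) in
  admissible par ->
  regular f g B par ->
  Lx par > 4 * mux par ->
  Ly par > 4 * muy par ->
  Lxy par > 18 * Num.max (muxy par)
                   (Num.max (muyx par) (Num.sqrt (mux par * muy par))) ->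
  Num.sqrt (Lx par * Ly par) > 4 * Num.max (muxy par) (muyx par) ->
  Num.min (delta_x par) (delta_y par) > 0 ->
  0 < eps -> (eps%:E < R2)%E ->
  (exists c : nat -> schedule, valid_schedules f g B par c) /\
  (forall c : nat -> schedule, valid_schedules f g B par c ->
   exists N : nat,
     [/\ (Rsq_xy (usubmx (restarted f g B par c N))
                  (dsubmx (restarted f g B par c N)) <= eps%:E)%E,
         (count_grad_f f g B par c N)%:R
           <= K * (Num.sqrt (kappa_x par) * logterm),
         (count_grad_g f g B par c N)%:R
           <= K * (Num.sqrt (kappa_y par) * logterm)
       & (count_matvec f g B par c N)%:R
           <= K * (Num.sqrt (kappa_xy par) * logterm)]).
Proof.
have a0 : 0 < ln (3 / 2 : R) by apply: ln_gt0; lra.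
exists (10 ^+ 5 * (2 / ln (3 / 2))); split.
  by rewrite mulr_gt0 ?exprn_gt0 ?divr_gt0.
move=> dx dy f g B par eps Rsq_xy R2 cst logterm adm reg_ok Lx4 Ly4 Lxy18 LL4 delta_gt0 eps0 epsR2.
have par_ok : conditions par by [].
split.
  have [c c_valid] := valid_schedule_exists par_ok reg_ok.
  by exists (fun=> c) => t; apply: c_valid.
move=> c c_valid.
have [_ _ _ [[x_pos x_min] [y_pos y_min]] _] := reg_ok.
have [Pix Pix_ok] := compatible_exists x_pos x_min.
have [Piy Piy_ok] : exists Piy, compatible g B^T (muyx par) Piy.
  by apply: compatible_exists; rewrite trmxK.
have [xs [ys [f_saddle g_saddle]]] := saddle_exists par_ok reg_ok Pix_ok Piy_ok.
have RsqE := Rsq_dist2 par_ok reg_ok Pix_ok Piy_ok f_saddle g_saddle.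
(* The initial distance is finite, so [fine R2] in the logarithm is its true value. *)
have R2E : R2 = (dist2 par Pix Piy xs ys 0)%:E by rewrite -RsqE !linear0.
have k1 := kappa_x_ge1 par_ok; have k2 := kappa_y_ge1 par_ok.
set d0 := dist2 _ _ _ _ _ 0 in R2E.
have d0_gt : eps < d0 by rewrite R2E lte_fin in epsR2.
have cst_ge : 25 <= cst by rewrite /cst; lra.
have X_ge : 3 / 2 <= cst * d0 / eps.
  rewrite ler_pdivlMr //.
  have : 25 * d0 <= cst * d0 by rewrite ler_wpM2r //; lra.
  lra.
have logE : logterm = ln (cst * d0 / eps) by rewrite /logterm R2E.
have [N [N_small N_le]] := restart_count X_ge; exists N.
rewrite -logE in N_le.
have count_le k (n : nat) : n%:R <= N%:R * (10 ^+ 5 * Num.sqrt k) ->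
    n%:R <= 10 ^+ 5 * (2 / ln (3 / 2)) * (Num.sqrt k * logterm).
  move=> n_le; apply: le_trans n_le _.
  have s0 : 0 <= 10 ^+ 5 * Num.sqrt k by rewrite mulr_ge0 ?exprn_ge0 ?sqrtr_ge0.
  have := ler_wpM2r s0 N_le; congr (_ <= _); ring.
split.
- rewrite /Rsq_xy RsqE lee_fin.
  have := restarted_dist2 par_ok reg_ok Pix_ok Piy_ok f_saddle g_saddle N c_valid.
  rewrite -/d0 -/cst; move/le_trans; apply.
  by move: N_small; rewrite mulrA ler_pdivrMr // mul1r.
- by apply: count_le; apply: count_grad_f_le.
- by apply: count_le; apply: count_grad_g_le.
- by apply: count_le; apply: count_matvec_le.
Qed.
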